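(* There are universal constants $C_1,C_2>0$ such that for every $n\ge 2$, if $X$ is the vertex set of an $n$-vertex planar graph with positive edge weights, equipped with the shortest path metric, then $X$ embeds into $\ell_\infty^{k}$ with $k\le C_1\log n$ and distortion at most $C_2$.
   Context: The distortion of an injective map $f:X\to Y$ between metric spaces is the least $K$ such that for some $c>0$, $cK^{-1}d_X(x,y)\le d_Y(f(x),f(y))\le c\,d_X(x,y)$ for all $x,y\in X$. $\ell_\infty^k$ is $\mathbb R^k$ with the max norm. *)

(* Defs.v *)
From mathcomp Require Export all_boot all_order all_algebra.
From mathcomp Require Export all_classical all_reals all_analysis.

Set Implicit Arguments.
Unset Strict Implicit.
Unset Printing Implicit Defensive.

Export Order.TTheory GRing.Theory Num.Theory.
Export numFieldNormedType.Exports.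

Local Open Scope classical_set_scope.
Local Open Scope ring_scope.

Definition simple_graph (V : finType) (e : rel V) : Prop :=
  symmetric e /\ irreflexive e.

Definition connected_graph (V : finType) (e : rel V) : Prop :=
  forall x y : V, connect e x y.

Definition positive_weights (R : realType) (V : finType) (e : rel V)
    (w : V -> V -> R) : Prop :=
  (forall x y, e x y -> w x y = w y x) /\ (forall x y, e x y -> 0 < w x y).

(* An edge {x, y} is drawn as the arc g x y, traversed from pos x to pos y;
   drawing_rev says that g y x is the same arc traversed backwards. *)
Record plane_drawing (R : realType) (V : finType) (e : rel V)
    (pos : V -> R * R) (g : V -> V -> R -> R * R) : Prop := PlaneDrawing {
  drawing_pos_inj : injective pos;
  drawing_continuous : forall x y, e x y ->
    {within `[0, 1]%classic, continuous (g x y)};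
  drawing_arc_inj : forall x y, e x y -> {in `[0, 1]%R &, injective (g x y)};
  drawing_source : forall x y, e x y -> g x y 0 = pos x;
  drawing_target : forall x y, e x y -> g x y 1 = pos y;
  drawing_rev : forall x y t, e x y -> t \in `[0, 1]%R ->
    g y x t = g x y (1 - t);
  drawing_avoids_vertices : forall x y z t, e x y -> t \in `]0, 1[%R ->
    g x y t <> pos z;
  drawing_no_crossing : forall x y x' y' s t, e x y -> e x' y' ->
    s \in `]0, 1[%R -> t \in `]0, 1[%R -> g x y s = g x' y' t ->
    (x = x' /\ y = y') \/ (x = y' /\ y = x')
}.

Definition planar (R : realType) (V : finType) (e : rel V) : Prop :=
  exists (pos : V -> R * R) (g : V -> V -> R -> R * R), plane_drawing e pos g.

Fixpoint walk_weight (R : realType) (V : finType) (w : V -> V -> R)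
    (x : V) (p : seq V) : R :=
  if p is y :: q then w x y + walk_weight w y q else 0.

(* The infimum is over a nonempty set (and is a minimum) when the graph is
   connected and the weights are positive. *)
Definition sp_dist (R : realType) (V : finType) (e : rel V)
    (w : V -> V -> R) (x y : V) : R :=
  inf [set walk_weight w x p | p in [set p | path e x p /\ last x p = y]].

(* 'rV[R]_k carries the max norm. *)
Definition linf_dist (R : realType) (k : nat) (u v : 'rV[R]_k) : R := `|u - v|.

(* K > 0 is needed: for K <= 0 the lower bound would be void. *)
Definition distortion_bound (R : realType) (X Y : Type) (dX : X -> X -> R)
    (dY : Y -> Y -> R) (f : X -> Y) (K : R) : Prop :=
  0 < K /\ exists c : R, 0 < c /\ forall x y : X,
    c * K^-1 * dX x y <= dY (f x) (f y) /\ dY (f x) (f y) <= c * dX x y.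

Definition is_distortion (R : realType) (X Y : Type) (dX : X -> X -> R)
    (dY : Y -> Y -> R) (f : X -> Y) (K : R) : Prop :=
  distortion_bound dX dY f K /\
  forall K' : R, distortion_bound dX dY f K' -> K <= K'.

(* Main.v *)
(* A K_{3,3} minor in a plane graph would give nine curves P_i -> Q_j of which
   independent ones are disjoint; but after polygonal approximation the number
   of crossings between independent curves is always odd. So the decomposition
   of Klein, Plotkin and Rao applies: cutting three times along annuli of
   shortest-path trees, with two possible shifts each, yields for each scale r
   eight partitions into clusters of diameter O(r), such that every ball of
   radius r lies inside a cluster of one of them.

   To use only O(log n) coordinates for all scales, coordinate t takes care at
   a point x of the scales r for which 2^t lies between the numbers of points
   of the balls of radius about r around x (measured descent). For d(x,y) of
   order r, one of x and y sees its ball grow at least twofold at scale r, so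
   that it has such a t. The clusters of one scale carry words over a
   16-letter alphabet indexed by t; a greedy choice, from the largest cluster
   to the smallest, makes the words of neighbouring clusters differ where
   needed, because there are at most M/m neighbours of size m in a region of M
   points. Coordinate (t, letter) is the truncated distance to the complement
   of the clusters having that letter at t; being a maximum over scales, it is
   1-Lipschitz. *)

Require Import Defs.
From mathcomp Require Import all_boot all_order all_algebra.
From mathcomp Require Import all_classical all_reals all_analysis.
From mathcomp Require Import zify ring lra.
Import Order.TTheory GRing.Theory Num.Theory numFieldNormedType.Exports.

Set Implicit Arguments.
Unset Strict Implicit.
Unset Printing Implicit Defensive.

Local Open Scope ring_scope.

(** * Shortest-path metrics *)

Section WalkMetric.
Variables (R : realType) (V : finType) (w : V -> V -> R).
Implicit Types (e f : rel V) (x y z : V) (p q : seq V).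

Lemma walk_weight_cat x p q :
  walk_weight w x (p ++ q) = walk_weight w x p + walk_weight w (last x p) q.
Proof. by elim: p x => [|y p IH] x /=; rewrite ?add0r // IH addrA. Qed.

Lemma walk_weight_ge0 e x p : positive_weights e w -> path e x p ->
  0 <= walk_weight w x p.
Proof.
move=> [_ wpos]; elim: p x => //= y p IH x /andP[exy pp].
by rewrite addr_ge0 ?IH // ltW // wpos.
Qed.

Lemma positive_weights_sub e f : subrel f e -> positive_weights e w ->
  positive_weights f w.
Proof. by move=> fe [ws wp]; split=> x y /fe; [apply: ws|apply: wp]. Qed.

Lemma walk_rev e x p : symmetric e -> positive_weights e w -> path e x p ->
  exists q, [/\ path e (last x p) q, last (last x p) q = x &
    walk_weight w (last x p) q = walk_weight w x p].
Proof.
move=> es [ws wp]; elim: p x => [|y p IH] x /=; first by exists [::].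
case/andP=> exy /IH [q [pq lq wq]]; exists (rcons q x).
rewrite rcons_path last_rcons pq lq es exy -cats1 walk_weight_cat lq wq /=.
by rewrite addr0 addrC (ws x y).
Qed.

Lemma sp_le e x p : positive_weights e w -> path e x p ->
  sp_dist e w x (last x p) <= walk_weight w x p.
Proof.
move=> pw pp; apply: ge_inf; last by exists p.
by exists 0 => _ [q [pq _] <-]; apply: walk_weight_ge0 pw pq.
Qed.

(** Induction along the walk: if the new start already lies on the simple walk obtained from the
    tail, everything before that place is dropped, which adds no weight. *)
Lemma walk_uniq e x p : positive_weights e w -> path e x p ->
  exists q, [/\ path e x q, last x q = last x p, uniq (x :: q) &
    walk_weight w x q <= walk_weight w x p].
Proof.
move=> pw; elim: p x => [|y p IH] x /=; first by exists [::].
case/andP=> exy /IH [q [pq lq uq wq]].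
have wxy : 0 < w x y by case: pw => _; apply.
have [xq|xq] := boolP (x \in y :: q); last first.
  by exists (y :: q); split; rewrite /= ?exy ?lerD2l // -cons_uniq /= xq.
case/splitPl: xq pq lq uq wq => q1 q2 lq1 pq lq uq wq.
move: pq; rewrite cat_path lq1 => /andP[pq1 pq2].
exists q2; split=> //.
- by rewrite -lq last_cat lq1.
- move: uq; rewrite -cat_cons cat_uniq => /and3P[_ /hasPn h ->]; rewrite andbT.
  by apply/negP => /h; rewrite -lq1 mem_last.
- apply: le_trans (ler_wpDl (ltW wxy) wq); rewrite walk_weight_cat lq1.
  by rewrite ler_wpDl // (walk_weight_ge0 pw pq1).
Qed.

Lemma sp_attained e x y : positive_weights e w -> connect e x y ->
  exists p, [/\ path e x p, last x p = y & walk_weight w x p = sp_dist e w x y].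
Proof.
move=> pw /connectP[p0 pp0 ->].
have [q0 [pq0 lq0 uq0 _]] := walk_uniq pw pp0.
(* Simple walks have at most [#|V|] steps, and sequences of bounded length form a finite type, on
   which a minimum exists. *)
pose P (p : (#|V|).-bseq V) := path e x p && (last x p == last x p0).
have szU q : uniq (x :: q) -> (size q <= #|V|)%N.
  move=> /card_uniqP h.
  by rewrite ltnW // -[(size q).+1]/(size (x :: q)) -h max_card.
pose b0 : (#|V|).-bseq V := Bseq (szU _ uq0).
have Pb0 : P b0 by rewrite /P /= pq0 lq0 eqxx.
case: (arg_minP (fun b => walk_weight w x (bseqval b)) Pb0) => b.
move=> /andP[pb /eqP lb] bmin.
exists b; split=> //; apply/le_anti/andP; split; last by rewrite -lb sp_le.
apply: lb_le_inf; first by exists (walk_weight w x p0), p0.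
move=> _ [q [pq lq] <-]; have [q' [pq' lq' uq' wq']] := walk_uniq pw pq.
apply: le_trans wq'; apply: (bmin (Bseq (szU _ uq'))).
by rewrite /P /= pq' lq' lq eqxx.
Qed.

Lemma sp_ge0 e x y : positive_weights e w -> 0 <= sp_dist e w x y.
Proof.
move=> pw; have [c|c] := boolP (connect e x y).
  by have [p [pp _ <-]] := sp_attained pw c; apply: walk_weight_ge0 pw pp.
(* Without any walk, the infimum is that of the empty set, which is 0 by convention. *)
rewrite /sp_dist; set A := (X in inf X).
suff -> : A = set0%classic by rewrite inf0.
rewrite -subset0 => z [p [pp lp] _]; case/negP: c.
by apply/connectP; exists p.
Qed.

Lemma sp_xx e x : positive_weights e w -> sp_dist e w x x = 0.
Proof.
move=> pw; apply/le_anti; rewrite (sp_ge0 _ _ pw) andbT.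
exact: (@sp_le e x [::] pw).
Qed.

Lemma sp_gt0 e x y : positive_weights e w -> connect e x y -> x != y ->
  0 < sp_dist e w x y.
Proof.
move=> pw c; have [p [pp lp <-]] := sp_attained pw c.
case: p pp lp => [|z p] /= pp lp.
  by rewrite lp eqxx.
case/andP: pp => exz pp _; rewrite ltr_pwDl ?(walk_weight_ge0 pw pp) //.
by case: pw => _; apply.
Qed.

Lemma sp_sym e x y : symmetric e -> positive_weights e w -> connect e x y ->
  sp_dist e w x y = sp_dist e w y x.
Proof.
move=> es pw.
have H a b : connect e a b -> sp_dist e w b a <= sp_dist e w a b.
  move=> c; have [p [pp lp <-]] := sp_attained pw c.
  have [q [pq lq <-]] := walk_rev es pw pp; move: pq lq; rewrite lp => pq lq.
  by rewrite -{1}lq sp_le.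
move=> c; apply/le_anti; rewrite !H //.
by rewrite (same_connect_r (sym_connect_sym es) c) connect0.
Qed.

Lemma sp_triangle e x y z : positive_weights e w -> connect e x y ->
  connect e y z -> sp_dist e w x z <= sp_dist e w x y + sp_dist e w y z.
Proof.
move=> pw cxy cyz.
have [p [pp lp <-]] := sp_attained pw cxy.
have [q [pq lq <-]] := sp_attained pw cyz.
have := @sp_le e x (p ++ q) pw; rewrite cat_path pp lp pq last_cat lp lq.
by rewrite walk_weight_cat lp; apply.
Qed.

Lemma sp_sub e f x y : subrel f e -> positive_weights e w -> connect f x y ->
  sp_dist e w x y <= sp_dist f w x y.
Proof.
move=> fe pw c; have pwf := positive_weights_sub fe pw.
have [p [pp lp <-]] := sp_attained pwf c.
by rewrite -lp; apply: sp_le => //; apply: sub_path pp.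
Qed.

End WalkMetric.

(** * Klein-Plotkin-Rao decompositions *)

Lemma all_prefix (V : eqType) (P : pred V) (x : V) (p : seq V) :
  (forall p1 p2, p = p1 ++ p2 -> P (last x p1)) -> all P (x :: p).
Proof.
move=> H; apply/allP => z /splitPl s; case: s H => p1 p2 <- H.
exact: (H p1 p2).
Qed.

Lemma first_hit (V : Type) (P : pred V) (x : V) (p : seq V) :
  ~~ P x -> P (last x p) ->
  exists p1 y p2, [/\ p = p1 ++ y :: p2, P y & ~~ P (last x p1)].
Proof.
elim: p x => [|y p IH] x /=; first by move/negP.
move=> nPx Pl; have [Py|nPy] := boolP (P y).
  by exists [::], y, p.
have [p1 [z [p2 [-> Pz nPl]]]] := IH y nPy Pl.
by exists (y :: p1), z, p2.
Qed.

(* Contracting the disjoint sets [L i] and [A j] gives a K_{3,3}; only the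
   walks matter, so the sets need not be connected. *)
Definition K33_walks (V : finType) (e : rel V) : Prop :=
  exists (L A : 'I_3 -> pred V) (l a : 'I_3 -> V) (p : 'I_3 -> 'I_3 -> seq V),
  [/\ (forall i, L i (l i)) /\ (forall j, A j (a j)),
      (forall i j z, L i z -> ~~ A j z),
      (forall i k z, i != k -> L i z -> ~~ L k z),
      (forall j k z, j != k -> A j z -> ~~ A k z) &
      (forall i j, [/\ path e (l i) (p i j), last (l i) (p i j) = a j &
         all (predU (L i) (A j)) (l i :: p i j)])].

Section Chop.
Variables (R : realType) (V : finType) (w : V -> V -> R).
Implicit Types (e : rel V) (x y z : V) (p q : seq V).

(** [fingraph.root e z] selects one vertex in every component, so one function serves all components
    of an already chopped graph. *)
Definition height e z : R := sp_dist e w (fingraph.root e z) z.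

Definition band (D s : R) e z : int := Num.floor ((height e z + s) / D).

Definition chop (D s : R) e : rel V :=
  [rel x y | e x y && (band D s e x == band D s e y)].

Lemma chop_sym D s e : symmetric e -> symmetric (chop D s e).
Proof. by move=> es x y; rewrite /chop /= es eq_sym. Qed.

Lemma chop_sub D s e : subrel (chop D s e) e.
Proof. by move=> x y /andP[]. Qed.

Lemma bandP D s e z (b : int) : 0 < D ->
  band D s e z = b <->
  b%:~R * D - s <= height e z < b%:~R * D - s + D.
Proof.
move=> D0; rewrite /band.
have E : (b%:~R <= (height e z + s) / D < b%:~R + 1) =
    (b%:~R * D - s <= height e z < b%:~R * D - s + D).
  by rewrite ler_pdivlMr // ltr_pdivrMr // mulrDl mul1r lerBlDr -ltrBrDr addrAC.
rewrite -E; split; last by move=> H; apply: floor_def; rewrite intrD.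
move=> <-; rewrite floor_le /=; have := floorD1_gt ((height e z + s) / D).
by rewrite intrD.
Qed.

Lemma band_connect D s e x y : connect (chop D s e) x y ->
  band D s e x = band D s e y.
Proof.
case/connectP => p pp ->; elim: p x pp => //= y' p IH x /andP[/andP[_ /eqP ->]].
exact: IH.
Qed.

Lemma chop_path D s e x p : path e x p ->
  all (fun v => band D s e v == band D s e x) (x :: p) -> path (chop D s e) x p.
Proof.
elim: p x => //= y p IH x /andP[exy pp] /and3P[_ /eqP yx ap].
have -> : chop D s e x y by rewrite /chop /= exy yx eqxx.
rewrite IH //= eqxx /=.
by apply: sub_all ap => v; rewrite yx.
Qed.

Section Height.
Variable e : rel V.
Hypotheses (es : symmetric e) (pw : positive_weights e w).

Let ces := sym_connect_sym es.

Lemma root_eq_connect x y : connect e x y ->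
  fingraph.root e x = fingraph.root e y.
Proof. by move/(fingraph.rootP ces). Qed.

Lemma height_root z : height e (fingraph.root e z) = 0.
Proof. by rewrite /height fingraph.root_root // sp_xx. Qed.

Lemma height_path x p : path e x p ->
  height e (last x p) <= height e x + walk_weight w x p.
Proof.
move=> pp; have cl : connect e x (last x p) by apply/connectP; exists p.
rewrite /height -(root_eq_connect cl).
apply: le_trans (sp_triangle pw _ cl) _; first by rewrite ces connect_root.
by rewrite lerD2l sp_le.
Qed.

Lemma height_path_rev x p : path e x p ->
  height e x <= height e (last x p) + walk_weight w x p.
Proof.
move=> pp; have [q [pq lq <-]] := walk_rev es pw pp.
by rewrite -{1}lq height_path.
Qed.

(** On a geodesic to the root, the height bounds for the parts before and after a vertex are both
    tight, because the two weights add up to the height of [x]. *)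
Lemma descend x : exists p, [/\ path e x p, last x p = fingraph.root e x &
  forall p1 p2, p = p1 ++ p2 ->
    height e (last x p1) = height e x - walk_weight w x p1].
Proof.
have c : connect e (fingraph.root e x) x by rewrite ces connect_root.
have [q [pq lq wq]] := sp_attained pw c.
have [p [pp lp wp]] := walk_rev es pw pq.
rewrite lq in pp lp wp; exists p; split=> // p1 p2 ep.
move: pp; rewrite ep cat_path => /andP[pp1 pp2].
have := height_path_rev pp1; have := height_path_rev pp2.
have -> : last (last x p1) p2 = fingraph.root e x by rewrite -lp ep last_cat.
rewrite height_root add0r.
have : walk_weight w x p = height e x by rewrite wp wq.
by rewrite ep walk_weight_cat => *; lra.
Qed.

Lemma sp_height_le x y : connect e x y ->
  sp_dist e w x y <= height e x + height e y.
Proof.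
move=> c; have rxy := root_eq_connect c.
have cx : connect e (fingraph.root e x) x by rewrite ces connect_root.
apply: le_trans (sp_triangle pw (connect_root e x) _) _.
  by rewrite rxy ces connect_root.
by rewrite (sp_sym es pw (connect_root e x)) {2}rxy.
Qed.

End Height.
End Chop.

(** * Three rounds of chopping, and the diameter of the clusters *)

Section KPR.
Variables (R : realType) (V : finType) (e : rel V) (w : V -> V -> R).
Hypotheses (es : symmetric e) (pw : positive_weights e w).
Hypothesis (econn : connected_graph e).
Variables (rho : R) (s : 'I_3 -> R).
Hypothesis rho0 : 0 < rho.

Let D := 4 * rho.
Let dG := sp_dist e w.
(** Edges longer than [rho] go first; then no step of a walk can jump over a range of heights or
    distances of width [D]. *)
Let e0 : rel V := [rel x y | e x y && (w x y <= rho)].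
Let e1 := chop w D (s 0) e0.
Let e2 := chop w D (s 1) e1.

Definition kpr_rel : rel V := chop w D (s 2%:R) e2.

Let e3 := kpr_rel.
Let D0 : 0 < D. Proof. by rewrite mulr_gt0. Qed.

Let e0s : symmetric e0.
Proof.
move=> x y; rewrite /e0 /= es; case exy : (e y x) => //=.
by case: pw => ws _; rewrite (ws y x exy).
Qed.
Let e1s : symmetric e1. Proof. exact: chop_sym. Qed.
Let e2s : symmetric e2. Proof. exact: chop_sym. Qed.

Lemma kpr_rel_sym : symmetric kpr_rel. Proof. exact: chop_sym. Qed.

Let s0 : subrel e0 e. Proof. by move=> x y /andP[]. Qed.
Let s10 : subrel e1 e0. Proof. exact: chop_sub. Qed.
Let s21 : subrel e2 e1. Proof. exact: chop_sub. Qed.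
Let s32 : subrel e3 e2. Proof. exact: chop_sub. Qed.
Let s1 : subrel e1 e. Proof. by move=> x y /s10/s0. Qed.
Let s2 : subrel e2 e. Proof. by move=> x y /s21/s1. Qed.

Let pw0 := positive_weights_sub s0 pw.
Let pw1 := positive_weights_sub s1 pw.
Let pw2 := positive_weights_sub s2 pw.

Let csub (f g : rel V) x y : subrel f g -> connect f x y -> connect g x y.
Proof. by move=> fg; apply: connect_sub => a b /fg /connect1. Qed.

Let h0 := height w e0.
Let h1 := height w e1.
Let h2 := height w e2.

Let dG_path (f : rel V) x p : subrel f e -> path f x p ->
  dG x (last x p) <= walk_weight w x p.
Proof. by move=> fe pp; apply: sp_le => //; apply: sub_path pp. Qed.

Let dG_height (f : rel V) x y : subrel f e -> symmetric f -> connect f x y ->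
  dG x y <= height w f x + height w f y.
Proof.
move=> fe fs c; apply: le_trans (sp_sub fe pw c) _.
by apply: (sp_height_le fs _ c); apply: positive_weights_sub pw.
Qed.

(* The annulus of each of the three rounds is a long way from its root, so the
   balls [A j] below the annuli are the three right-hand branch sets; the
   left-hand ones grow from [x i] along geodesics towards these roots.  The
   geodesic of round 0 starts only after leaving the annulus of round 1, so as
   not to meet [A 2]. *)
Lemma far_K33 (x : 'I_3 -> V) :
  (forall i, connect e3 (x 0) (x i)) ->
  (forall i j, i != j -> 10 * D < dG (x i) (x j)) ->
  K33_walks e.
Proof.
move=> cx far.
have c2 i : connect e2 (x 0) (x i) by apply: csub s32 (cx i).
have c1 i : connect e1 (x 0) (x i) by apply: csub s21 (c2 i).
have c0 i : connect e0 (x 0) (x i) by apply: csub s10 (c1 i).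
pose t0 := (band w D (s 0) e0 (x 0))%:~R * D - s 0.
pose t1 := (band w D (s 1) e1 (x 0))%:~R * D - s 1.
pose t2 := (band w D (s 2%:R) e2 (x 0))%:~R * D - s 2%:R.
have B0 z : connect e1 (x 0) z -> t0 <= h0 z < t0 + D.
  by move=> /band_connect c; apply/bandP.
have B1 z : connect e2 (x 0) z -> t1 <= h1 z < t1 + D.
  by move=> /band_connect c; apply/bandP.
have B2 z : connect e3 (x 0) z -> t2 <= h2 z < t2 + D.
  by move=> /band_connect c; apply/bandP.
have D0' := D0.
have far01 : 10 * D < dG (x 0) (x 1) by apply: far.
(* Two points of one component more than [10 * D] apart have heights with a sum above [10 * D]. Both
   heights being below [t + D], each of [t0], [t1], [t2] exceeds [4 * D]. *)
have P0 : 0 < t0.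
  have := dG_height s0 e0s (c0 1).
  have /andP[_ a] := B0 _ (c1 0); have /andP[_ b] := B0 _ (c1 1).
  by move: a b; rewrite /h0 => *; lra.
have P1 : 0 < t1 - 4 * D.
  have := dG_height s1 e1s (c1 1).
  have /andP[_ a] := B1 _ (c2 0); have /andP[_ b] := B1 _ (c2 1).
  by move: a b; rewrite /h1 => *; lra.
have P2 : 0 < t2 - D.
  have := dG_height s2 e2s (c2 1).
  have /andP[_ a] := B2 _ (cx 0); have /andP[_ b] := B2 _ (cx 1).
  by move: a b; rewrite /h2 => *; lra.
(* The gap [4 * D] in [A1] leaves room for the geodesics of round 0, which will start between
   [t1 - 3 * D] and [t1 - 2 * D]. The gap [D] in [A2] keeps it clear of the geodesics of round 1. *)
pose A0 : pred V := fun z => connect e0 (x 0) z && (h0 z < t0).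
pose A1 : pred V := fun z => connect e1 (x 0) z && (h1 z < t1 - 4 * D).
pose A2 : pred V := fun z => connect e2 (x 0) z && (h2 z < t2 - D).
(* The longest walk inside [L i] descends from below [t1 + D] to [t1 - 4 * D], whence the radius
   [5 * D]; by [far] these balls are disjoint. *)
pose L i : pred V :=
  fun z => [&& dG (x i) z <= 5 * D, ~~ A0 z, ~~ A1 z & ~~ A2 z].
have nA0 z : connect e1 (x 0) z -> ~~ A0 z.
  by move=> /B0/andP[a _]; rewrite /A0 negb_and -leNgt a orbT.
have nA1 z : connect e2 (x 0) z -> ~~ A1 z.
  move=> /B1/andP[a _]; rewrite /A1 negb_and -leNgt; apply/orP; right.
  by lra.
have [q2 Hq2] := choice (fun i => descend e2s pw2 (x i)); rewrite -/h2 in Hq2.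
have [q1 Hq1] := choice (fun i => descend e1s pw1 (x i)); rewrite -/h1 in Hq1.
have L2 i p1 p2 : q2 i = p1 ++ p2 -> t2 - D <= h2 (last (x i) p1) ->
    L i (last (x i) p1).
  move=> E hz; have [pq _ H] := Hq2 i; have Hz := H _ _ E.
  move: pq; rewrite E cat_path => /andP[pp1 _].
  have cz : connect e2 (x 0) (last (x i) p1).
    by apply: connect_trans (c2 i) _; apply/connectP; exists p1.
  apply/and4P; split; [|exact/nA0/(csub s21)|exact: nA1|].
    have := dG_path s2 pp1; have /andP[_ b] := B2 _ (cx i); move: b.
    by rewrite /dG => *; lra.
  by rewrite /A2 negb_and -leNgt hz orbT.
have L1 i p1 p2 : q1 i = p1 ++ p2 -> t1 - 4 * D <= h1 (last (x i) p1) ->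
    L i (last (x i) p1).
  move=> E hz; have [pq _ H] := Hq1 i; have Hz := H _ _ E.
  move: pq; rewrite E cat_path => /andP[pp1 _].
  have cz : connect e1 (x 0) (last (x i) p1).
    by apply: connect_trans (c1 i) _; apply/connectP; exists p1.
  have /andP[_ bi] := B1 _ (c2 i).
  apply/and4P; split; [|exact: nA0| |].
  - by have := dG_path s1 pp1; rewrite /dG => *; lra.
  - by rewrite /A1 negb_and -leNgt hz orbT.
  (* A point of [A2] lies in the annulus of round 1. The descent to it then never left that annulus,
     so it is a walk of [e2] shorter than [D], and [h2] cannot have dropped below [t2 - D]. *)
  rewrite /A2; apply/negP => /andP[cz2 hz2].
  have /andP[lz _] := B1 _ cz2.
  have pp2 : path e2 (x i) p1.
    apply: (chop_path pp1); apply: all_prefix => a b Eab.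
    apply/eqP; rewrite -(band_connect (c2 i)); apply/bandP => //.
    rewrite -/t1 -/h1.
    have Ha : h1 (last (x i) a) = h1 (x i) - walk_weight w (x i) a.
      by apply: (H a (b ++ p2)); rewrite E Eab catA.
    move: pp1; rewrite Eab cat_path => /andP[/(walk_weight_ge0 pw1) ga].
    move=> /(walk_weight_ge0 pw1) gb.
    move: Hz; rewrite {2}Eab walk_weight_cat => Hz.
    by apply/andP; split; lra.
  have := height_path_rev e2s pw2 pp2; have /andP[b2 _] := B2 _ (cx i).
  by rewrite -/h2 => *; lra.
have rD : rho <= D by rewrite ler_peMl ?ltW // ltr1n.
(* [u i] follows the geodesic of round 1 until its height first falls below [t1 - 2 * D]; the last
   step, of weight at most [rho], does not overshoot [t1 - 3 * D]. *)
have piv i : exists u, [/\ path e1 (x i) u, all (L i) (x i :: u),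
    walk_weight w (x i) u <= 4 * D, t1 - 3 * D <= h1 (last (x i) u) &
    h1 (last (x i) u) < t1 - 2 * D].
  have [pq lq H] := Hq1 i; have /andP[bi ub] := B1 _ (c2 i).
  have [||p1 [y [p2 [E Py nP]]]] :=
      @first_hit _ (fun z => h1 z < t1 - 2 * D) (x i) (q1 i).
  - by rewrite -leNgt; lra.
  - by rewrite lq /h1 height_root //; lra.
  have E' : q1 i = rcons p1 y ++ p2 by rewrite E cat_rcons.
  have hy : t1 - 3 * D <= h1 y.
    have := pq; rewrite E cat_path /= => /and3P[pp1 ly _].
    have /andP[_ lw] := s10 ly.
    have pp : path e1 (last (x i) p1) [:: y] by rewrite /= ly.
    have := height_path_rev e1s pw1 pp; rewrite /= addr0 -/h1.
    by move: nP; rewrite -leNgt => *; lra.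
  have Hy := H (rcons p1 y) p2 E'; rewrite last_rcons in Hy.
  exists (rcons p1 y); rewrite last_rcons; split=> //; last by lra.
    by move: pq; rewrite E' cat_path => /andP[].
  apply: all_prefix => a b Eab.
  have Ea : q1 i = a ++ (b ++ p2) by rewrite E' Eab catA.
  apply: (L1 i a (b ++ p2) Ea).
  rewrite (H a _ Ea); move: Hy; rewrite Eab walk_weight_cat => Hy.
  have gb : 0 <= walk_weight w (last (x i) a) b.
    move: pq; rewrite Ea cat_path cat_path => /and3P[_ + _].
    exact: walk_weight_ge0.
  by lra.
have [u Hu] := choice piv.
pose y i := last (x i) (u i).
have [q0 Hq0] := choice (fun i => descend e0s pw0 (y i)); rewrite -/h0 in Hq0.
have cy i : connect e1 (x 0) (y i).
  apply: connect_trans (c1 i) _; have [pu _ _ _ _] := Hu i.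
  by apply/connectP; exists (u i).
have LA0 i : all (predU (L i) A0) (y i :: q0 i).
  have [pu _ wu ly uy] := Hu i; have [pq _ H] := Hq0 i.
  apply: all_prefix => p1 p2 E; apply/orP; have Hz := H _ _ E.
  move: pq; rewrite E cat_path => /andP[pp1 _].
  have cz : connect e0 (x 0) (last (y i) p1).
    apply: connect_trans (csub s10 (cy i)) _.
    by apply/connectP; exists p1.
  have [lz|lz] := ltP (h0 (last (y i) p1)) t0; [right|left].
    by rewrite /A0 /= cz.
  have /andP[_ by0] := B0 _ (cy i).
  (* As long as the descent has not passed below [t0], it stays in the annulus of round 0 and is
     shorter than [D]. Hence [h1] stays above [A1] and below [t1], thus off the annulus of round 1,
     which contains [A2]. *)
  have pp2 : path e1 (y i) p1.
    apply: (chop_path pp1); apply: all_prefix => a b Eab.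
    apply/eqP; rewrite -(band_connect (cy i)); apply/bandP => //.
    rewrite -/t0 -/h0.
    have Ha : h0 (last (y i) a) = h0 (y i) - walk_weight w (y i) a.
      by apply: (H a (b ++ p2)); rewrite E Eab catA.
    move: pp1; rewrite Eab cat_path => /andP[/(walk_weight_ge0 pw0) ga].
    move=> /(walk_weight_ge0 pw0) gb.
    move: Hz; rewrite {2}Eab walk_weight_cat -/h0 => Hz.
    by apply/andP; split; lra.
  have cz1 : connect e1 (x 0) (last (y i) p1).
    by apply: connect_trans (cy i) _; apply/connectP; exists p1.
  have := height_path_rev e1s pw1 pp2; have := height_path e1s pw1 pp2.
  rewrite -/h1 => hz1 hz2.
  apply/and4P; split; [|exact: nA0| |].
  - have : dG (x i) (last (x i) (u i ++ p1)) <= walk_weight w (x i) (u i ++ p1).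
      by apply: (dG_path s1); rewrite cat_path pu.
    by rewrite last_cat walk_weight_cat -/(y i) => *; lra.
  - rewrite /A1 negb_and -leNgt; apply/orP; right.
    by rewrite -/(y i) in ly; lra.
  rewrite /A2; apply/negP => /andP[/B1/andP[cz2 _] _].
  by rewrite -/(y i) in uy; lra.
have LA1 i : all (predU (L i) A1) (x i :: q1 i).
  have [pq _ H] := Hq1 i; apply: all_prefix => p1 p2 E; apply/orP.
  have [lz|lz] := ltP (h1 (last (x i) p1)) (t1 - 4 * D); [right|left].
    rewrite /= /A1 lz andbT; apply: connect_trans (c1 i) _.
    by apply/connectP; exists p1 => //; move: pq; rewrite E cat_path => /andP[].
  exact: L1 E lz.
have LA2 i : all (predU (L i) A2) (x i :: q2 i).
  have [pq _ H] := Hq2 i; apply: all_prefix => p1 p2 E; apply/orP.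
  have [lz|lz] := ltP (h2 (last (x i) p1)) (t2 - D); [right|left].
    rewrite /= /A2 lz andbT; apply: connect_trans (c2 i) _.
    by apply/connectP; exists p1 => //; move: pq; rewrite E cat_path => /andP[].
  exact: L2 E lz.
exists L, (fun j => nth xpred0 [:: A0; A1; A2] j), x,
  (fun j => nth (x 0) [:: fingraph.root e0 (x 0); fingraph.root e1 (x 0);
    fingraph.root e2 (x 0)] j),
  (fun i j => nth [::] [:: u i ++ q0 i; q1 i; q2 i] j).
split.
- split=> [i|].
    by have [_ /andP[]] := Hu i.
  case=> [[|[|[|//]]] /= _].
  + by rewrite /A0 connect_root /h0 height_root.
  + by rewrite /A1 connect_root /h1 height_root.
  + by rewrite /A2 connect_root /h2 height_root.
- move=> i [[|[|[|//]]] /= _] z /and4P[_ ? ? ?] //.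
- move=> i k z ik /andP[li _]; apply/negP => /andP[lk _].
  have := far _ _ ik; have := sp_triangle pw (econn (x i) z) (econn z (x k)).
  by rewrite (sp_sym es pw (econn z (x k))) -/dG => *; lra.
- have nA01 z : A0 z -> A1 z -> False by move=> A0z /andP[/nA0]; rewrite A0z.
  have nA02 z : A0 z -> A2 z -> False.
    by move=> A0z /andP[/(csub s21)/nA0]; rewrite A0z.
  have nA12 z : A1 z -> A2 z -> False by move=> A1z /andP[/nA1]; rewrite A1z.
  move=> [[|[|[|//]]] /= ?] [[|[|[|//]]] /= ?] z //= _ Az; apply/negP => Az';
    by [apply: nA01 Az Az'|apply: nA02 Az Az'|apply: nA12 Az Az'|
        apply: nA01 Az' Az|apply: nA02 Az' Az|apply: nA12 Az' Az].
move=> i [[|[|[|//]]] /= _].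
- have [pu au _ _ _] := Hu i; have [pq lq _] := Hq0 i.
  split.
  + by rewrite cat_path (sub_path s1 pu) (sub_path s0 pq).
  + rewrite last_cat lq; apply/esym/root_eq_connect => //.
    exact: csub s10 (cy i).
  + rewrite -[_ && _]/(all (predU (L i) A0) ((x i :: u i) ++ q0 i)) all_cat.
    apply/andP; split.
      by apply: sub_all au => z /= ->.
    by case/andP: (LA0 i).
- have [pq lq _] := Hq1 i; split; [exact: sub_path s1 _ _ pq| |exact: LA1].
  by rewrite lq; apply/esym/root_eq_connect.
- have [pq lq _] := Hq2 i; split; [exact: sub_path s2 _ _ pq| |exact: LA2].
  by rewrite lq; apply/esym/root_eq_connect.
Qed.

(** On a walk inside the cluster, the first vertex more than [10 * D] from [x] is at most [11 * D]
    away. If [y] were beyond [21 * D], these three points would satisfy [far_K33]. *)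
Lemma kpr_diam x y : ~ K33_walks e -> connect kpr_rel x y -> dG x y <= 21 * D.
Proof.
move=> nK cxy; rewrite leNgt; apply/negP => far; apply: nK.
have D0' := D0; have rD : rho <= D by rewrite ler_peMl ?ltW // ltr1n.
have [p pp lp] := connectP cxy.
have dxx : dG x x = 0 by apply: sp_xx.
have [||p1 [z [p2 [E Pz nPz]]]] := @first_hit _ (fun z => 10 * D < dG x z) x p.
- by rewrite dxx -leNgt; lra.
- by rewrite -lp; lra.
move: pp; rewrite E cat_path /= => /and3P[pp1 elz _].
have pz : path e3 x (rcons p1 z) by rewrite rcons_path pp1.
have cxz : connect e3 x z.
  by apply/connectP; exists (rcons p1 z) => //; rewrite last_rcons.
have uz : dG x z <= 11 * D.
  have /andP[ez wz] := s10 (s21 (s32 elz)).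
  have pe : path e (last x p1) [:: z] by rewrite /= ez.
  have := sp_triangle pw (econn x (last x p1)) (econn (last x p1) z).
  have := sp_le pw pe; rewrite /= addr0 -leNgt in nPz *.
  by rewrite -/dG => *; lra.
have zy : 10 * D < dG z y.
  by have := sp_triangle pw (econn x z) (econn z y); rewrite -/dG => *; lra.
have xy : 10 * D < dG x y by lra.
have dGC a b : dG a b = dG b a by apply: sp_sym.
apply: (@far_K33 (fun i => nth x [:: x; z; y] i)).
  by case=> [[|[|[|//]]] /= _]; rewrite ?connect0.
by move=> [[|[|[|//]]] /= ?] [[|[|[|//]]] /= ?] //= _; rewrite // dGC.
Qed.

End KPR.

(** * Small balls survive all three rounds for some choice of shifts *)

Section Padding.
Variables (R : realType) (V : finType) (e : rel V) (w : V -> V -> R).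
Hypotheses (es : symmetric e) (pw : positive_weights e w).
Variables (rho : R) (x : V).
Hypothesis rho0 : 0 < rho.

Let D := 4 * rho.

(** Stated for walks of [e] and not for balls, since each chopped relation has its own metric; a
    walk that survives one round can be fed to the next. *)
Definition short_walks_in (f : rel V) :=
  forall p, path e x p -> walk_weight w x p <= rho -> path f x p.

(** The boundaries for the two shifts alternate at distance [2 * rho]; the shift whose boundaries
    are farther from [h] keeps them at least [rho] away. *)
Lemma shift_choice (h : R) : exists (b : bool) (k : int),
  let t := k%:~R * D - (if b then D / 2 else 0) in
  t <= h - rho /\ h + rho < t + D.
Proof.
have D0 : 0 < D by rewrite mulr_gt0.
have := floor_le (h / D); have := floorD1_gt (h / D).
rewrite intrD ltr_pdivrMr // ler_pdivlMr // mulrDl mul1r.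
set k := Num.floor _; set kD := k%:~R * D => u l.
have [a|a] := ltP (h - kD) rho.
  by exists true, k; rewrite -/kD /D /=; rewrite /D in u; split; lra.
have [b|b] := ltP (h - kD) (3 * rho).
  by exists false, k; rewrite -/kD /D /=; rewrite /D in u; split; lra.
exists true, (k + 1); rewrite intrD mulrDl mul1r -/kD /D /=.
by rewrite /D in u; split; lra.
Qed.

Lemma pad_step (f : rel V) : subrel f e -> symmetric f -> short_walks_in f ->
  exists b : bool, short_walks_in (chop w D (if b then D / 2 else 0) f).
Proof.
move=> fe fs H; have [b [k [lk uk]]] := shift_choice (height w f x).
have pwf := positive_weights_sub fe pw.
exists b => p pp wp; have pf := H p pp wp.
have D0 : 0 < D by rewrite mulr_gt0.
have bk (z : V) : height w f x - rho <= height w f z <= height w f x + rho ->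
    band w D (if b then D / 2 else 0) f z = k.
  by case/andP=> l u; apply/bandP => //; apply/andP; split; lra.
apply: (chop_path pf); apply: all_prefix => p1 p2 E.
move: pf wp; rewrite E cat_path walk_weight_cat => /andP[pf1 pf2] wp.
have w1 := walk_weight_ge0 pwf pf1; have w2 := walk_weight_ge0 pwf pf2.
have := height_path fs pwf pf1; have := height_path_rev fs pwf pf1 => a c.
by rewrite !bk //; apply/andP; split; lra.
Qed.

Definition kpr_shift (c : {ffun 'I_3 -> bool}) (i : 'I_3) : R :=
  if c i then D / 2 else 0.

Lemma kpr_pad : exists c : {ffun 'I_3 -> bool},
  short_walks_in (kpr_rel e w rho (kpr_shift c)).
Proof.
pose e0 : rel V := [rel x y | e x y && (w x y <= rho)].
have e0s : symmetric e0.
  move=> a b; rewrite /e0 /= es; case eab : (e b a) => //=.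
  by case: pw => ws _; rewrite (ws b a eab).
have s0 : subrel e0 e by move=> a b /andP[].
have sw0 : short_walks_in e0.
  rewrite /short_walks_in => p; elim: p x => //= z p IH y /andP[eyz pp] wl.
  have wp := walk_weight_ge0 pw pp; have wz : 0 < w y z by case: pw => _; apply.
  have -> : e0 y z by rewrite /e0 /= eyz /=; lra.
  by rewrite IH //; lra.
have [b0 sw1] := pad_step s0 e0s sw0; set f1 := chop _ _ _ _ in sw1.
have s1 : subrel f1 e by move=> a b /(@chop_sub _ _ _ _ _ _) /s0.
have [b1 sw2] := pad_step s1 (chop_sym _ _ _ e0s) sw1.
set f2 := chop _ _ _ f1 in sw2.
have s2 : subrel f2 e by move=> a b /(@chop_sub _ _ _ _ _ _) /s1.
have [b2 sw3] := pad_step s2 (chop_sym _ _ _ (chop_sym _ _ _ e0s)) sw2.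
exists [ffun i : 'I_3 => nth false [:: b0; b1; b2] i].
by rewrite /kpr_rel /kpr_shift !ffunE.
Qed.

End Padding.

(** A cluster is a component of [kpr_rel], named by its root. The bound is [21 * D] with
    [D = 4 * rho], and [c] ranges over the [2 ^ 3] choices of shifts. *)
Theorem kpr_partitions (R : realType) (V : finType) (e : rel V)
    (w : V -> V -> R) (rho : R) :
  symmetric e -> positive_weights e w -> connected_graph e ->
  ~ K33_walks e -> 0 < rho ->
  exists P : {ffun 'I_3 -> bool} -> V -> V,
    (forall c x y, P c x = P c y -> sp_dist e w x y <= 84 * rho) /\
    (forall x, exists c, forall y, sp_dist e w x y <= rho -> P c x = P c y).
Proof.
move=> es pw econn nK rho0.
exists (fun c => fingraph.root (kpr_rel e w rho (kpr_shift rho c))).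
split=> [c x y|x].
  move/(fingraph.rootP (sym_connect_sym (kpr_rel_sym es pw rho _))) => cxy.
  by have := kpr_diam es pw econn rho0 nK cxy; rewrite mulrA -natrM.
have [c H] := kpr_pad es pw x rho0; exists c => y dxy.
apply/(fingraph.rootP (sym_connect_sym (kpr_rel_sym es pw rho _))).
have [p [pp lp wp]] := sp_attained pw (econn x y).
by apply/connectP; exists p => //; apply: H => //; rewrite wp.
Qed.

(** * Plane drawings *)

(** Continuous induction: the supremum of the parameters reached by chains is itself reached, and
    could be exceeded if it were less than 1. *)
Lemma arc_chain (R : realType) (g : R -> R * R) (eta : R) : 0 < eta ->
  {within `[0, 1], continuous g}%classic ->
  exists s : seq R, [/\ all (fun t => t \in `[0, 1]%R) s, last 0 s = 1 &
    path (fun u v => `|g u - g v| < eta) 0 s].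
Proof.
move=> eta0 /subspace_continuousP cg.
pose A := [set t : R | exists s : seq R, [/\ all (fun t => t \in `[0, 1]%R) s,
  last 0 s = t & path (fun u v => `|g u - g v| < eta) 0 s]]%classic.
have A0 : A 0 by exists [::].
have Ale t : A t -> 0 <= t <= 1.
  move=> [s [al <- _]]; case/lastP: s al => [|s z] /=.
    by rewrite lexx ler01.
  by rewrite all_rcons last_rcons => /andP[]; rewrite in_itv.
have supA : has_sup A by split; [exists 0|exists 1 => t /Ale/andP[]].
have s0 : 0 <= sup A by apply: sup_upper_bound.
have s1 : sup A <= 1 by apply: ge_sup => [|t /Ale/andP[]] //; exists 0.
have sI : `[0, 1]%classic (sup A) by rewrite /= in_itv /= s0.
have e20 : 0 < eta / 2 by rewrite divr_gt0.
have /cvgrPdist_lt /(_ _ e20) := cg _ sI.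
rewrite near_withinE => /nbhs_ballP[d /= d0 Hd].
have [a Aa la] := sup_adherent d0 supA.
(* Both [a] and [u] are within [d] of the supremum, so their images are each [eta / 2] close to its
   image. *)
have step u : 0 <= u <= 1 -> `|sup A - u| < d -> A u.
  move=> u01 ud; have [s [al ls ps]] := Aa.
  exists (rcons s u); rewrite all_rcons last_rcons al in_itv /= u01; split=> //.
  rewrite rcons_path ps ls /=.
  have aI := Ale _ Aa; have aS : a <= sup A by apply: sup_upper_bound.
  have Ha := Hd a; have Hu := Hd u.
  have := Ha _ _; rewrite /ball /= in_itv /= => /(_ _ aI) {}Ha.
  have := Hu _ _; rewrite /ball /= in_itv /= => /(_ ud u01) {}Hu.
  have {}Ha : `|g (sup A) - g a| < eta / 2.
    by apply: Ha; rewrite ger0_norm; lra.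
  rewrite -(subrKA (g (sup A))) (le_lt_trans (ler_normD _ _)) //.
  by rewrite [ltRHS](splitr eta) ltrD // distrC.
have [lt1|ge1] := ltP (sup A) 1; last first.
  apply: step; rewrite ?lexx ?ler01 //.
  by have -> : sup A = 1; [lra|rewrite subrr normr0].
pose u := Num.min 1 (sup A + d / 2).
have d2 : 0 < d / 2 by rewrite divr_gt0.
have us : sup A < u by rewrite lt_min lt1 ltrDl.
have Au : A u.
  have u1 : u <= 1 by rewrite ge_min lexx.
  have u2 : u <= sup A + d / 2 by rewrite ge_min lexx orbT.
  by apply: step; [lra|rewrite ler0_norm; lra].
by have := sup_upper_bound supA Au; lra.
Qed.

(** The distance is continuous on the product of the two compact arcs, so it attains a minimum,
    which is positive. *)
Lemma disjoint_arcs_dist (R : realType) (g h : R -> R * R) :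
  {within `[0, 1], continuous g}%classic ->
  {within `[0, 1], continuous h}%classic ->
  (forall s t, s \in `[0, 1]%R -> t \in `[0, 1]%R -> g s <> h t) ->
  exists2 d : R, 0 < d & forall s t, s \in `[0, 1]%R -> t \in `[0, 1]%R ->
    d <= `|g s - h t|.
Proof.
move=> cg ch gh.
have kg := continuous_compact cg (@segment_compact _ 0 1).
have kh := continuous_compact ch (@segment_compact _ 0 1).
pose f (u : (R * R) * (R * R)) : R := `|u.1 - u.2|.
have cf : continuous f.
  move=> u; apply: (@cvg_norm _ _ _ _ _ (fun u => u.1 - u.2)).
  by apply: cvgB; [apply: cvg_fst|apply: cvg_snd].
have [|u] := @compact_EVT_min _ _ f _ _ (compact_setX kg kh)
    (continuous_subspaceT cf).
  exists (g 0, h 0); split; exists 0 => //=; by rewrite in_itv /= lexx ler01.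
rewrite inE => -[[s sI gs] [t tI ht]] umin.
exists (f u).
  rewrite /f -gs -ht normr_gt0 subr_eq0; apply/eqP.
  by apply: gh.
move=> a b aI bI; apply: (umin (g a, h b)).
by rewrite inE; split; [exists a|exists b].
Qed.

(** In the sum of the equations [E1] to [E18], all terms but the [qq] occur an even number of times,
    while the [qq] terms add up to 9. *)
Lemma K33_parity (rp rq : 'I_3 -> 'I_3 -> 'I_3 -> nat)
    (pp pq qp qq : 'I_3 -> 'I_3 -> nat) :
  (forall i j k l, i != k -> j != l -> exists n,
    (rp i k l + rq j k l + (rp k i j + (pp i k + qp j k) +
      (rq l i j + (pq i l + qq j l))) = n.*2)%N) ->
  (forall i j, i != j -> qq i j + qq j i = 1)%N -> False.
Proof.
move=> EN ne.
pose a : 'I_3 := Ordinal (isT : 0 < 3)%N.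
pose b : 'I_3 := Ordinal (isT : 1 < 3)%N.
pose c : 'I_3 := Ordinal (isT : 2 < 3)%N.
have [n1 E1] := EN a a b b isT isT.
have [n2 E2] := EN a a b c isT isT.
have [n3 E3] := EN a b b a isT isT.
have [n4 E4] := EN a b b c isT isT.
have [n5 E5] := EN a c b a isT isT.
have [n6 E6] := EN a c b b isT isT.
have [n7 E7] := EN a a c b isT isT.
have [n8 E8] := EN a a c c isT isT.
have [n9 E9] := EN a b c a isT isT.
have [n10 E10] := EN a b c c isT isT.
have [n11 E11] := EN a c c a isT isT.
have [n12 E12] := EN a c c b isT isT.
have [n13 E13] := EN b a c b isT isT.
have [n14 E14] := EN b a c c isT isT.
have [n15 E15] := EN b b c a isT isT.
have [n16 E16] := EN b b c c isT isT.
have [n17 E17] := EN b c c a isT isT.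
have [n18 E18] := EN b c c b isT isT.
have Q1 := ne a b isT; have Q2 := ne a c isT; have Q3 := ne b c isT.
by clear EN ne; lia.
Qed.

(** * Parity of the crossings of rectilinear polylines *)

Section CrossingParity.
Variables (T : Type) (lx ly : rel T).
Implicit Types (a b c d v : T) (p q : seq T).

(* A step from [a] to [b] is drawn as a horizontal segment at the height of
   [a] followed by a vertical one at the abscissa of [b]; [cross_step] is the
   parity of the number of crossings of two such steps. *)
Definition cross_step a b c d : bool :=
  ((lx a d (+) lx b d) && (ly c a (+) ly d a)) (+)
  ((lx b c (+) lx b d) && (ly c a (+) ly c b)).

(** Whether the horizontal ray from [v] to the right meets the vertical part of the step from [c] to
    [d]; [coray_step] is the same for the ray to the left. *)
Let ray_step v c d : bool := lx v d && (ly c v (+) ly d v).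
Let coray_step v a b : bool := lx b v && (ly v a (+) ly v b).

Fixpoint step_sum (F : T -> T -> bool) a p : bool :=
  if p is b :: q then F a b (+) step_sum F b q else false.

Definition cross a p c q : bool :=
  step_sum (fun a b => step_sum (cross_step a b) c q) a p.
Definition ray v c q : bool := step_sum (ray_step v) c q.
Definition coray v a p : bool := step_sum (coray_step v) a p.

Lemma cross_stepE a b c d : cross_step a b c d =
  ray_step a c d (+) ray_step b c d (+) (coray_step c a b (+) coray_step d a b).
Proof.
rewrite /cross_step /ray_step /coray_step.
by case: (lx a d); case: (lx b d); case: (lx b c); case: (ly c a);
  case: (ly d a); case: (ly c b); case: (ly d b).
Qed.

Lemma step_sum0 (F : T -> T -> bool) a p :
  path (fun a b => ~~ F a b) a p -> step_sum F a p = false.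
Proof. by elim: p a => //= b p IH a /andP[/negbTE -> /IH]. Qed.

(** By [cross_stepE], two steps contribute ray terms at the ends of each; summed along both
    polylines these telescope. *)
Lemma crossE a p c q : cross a p c q =
  ray a c q (+) ray (last a p) c q (+) (coray c a p (+) coray (last c q) a p).
Proof.
have S a' b' : step_sum (cross_step a' b') c q =
    ray a' c q (+) ray b' c q (+)
    (coray_step c a' b' (+) coray_step (last c q) a' b').
  rewrite /ray; elim: q c => [|d q IH] c /=; first by rewrite !addbb.
  rewrite IH cross_stepE.
  set r1 := ray_step a' _ _; set r2 := ray_step b' _ _.
  set u := step_sum _ _ _; set v := step_sum _ _ _.
  set x := coray_step _ _ _; set y := coray_step _ _ _.
  set z := coray_step _ _ _.
  by case: r1; case: r2; case: u; case: v; case: x; case: y; case: z.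
rewrite /cross /coray; elim: p a => [|b p IH] a /=; first by rewrite !addbb.
rewrite IH S /coray.
set r1 := ray _ _ _; set r2 := ray b _ _; set r3 := ray _ _ _.
set x := coray_step _ _ _; set y := coray_step _ _ _.
set u := step_sum _ _ _; set v := step_sum _ _ _.
by case: r1; case: r2; case: r3; case: u; case: v; case: x; case: y.
Qed.

Definition strictly_ordered v d := lx v d = ~~ lx d v /\ ly v d = ~~ ly d v.

(** The two rays from [v] form a line, which the polyline crosses an odd number of times exactly
    when its ends lie on different sides. *)
Lemma corayE v c q : (forall d, List.In d (c :: q) -> strictly_ordered v d) ->
  coray v c q = ray v c q (+) (ly c v (+) ly (last c q) v).
Proof.
rewrite /coray /ray; elim: q c => [|d q IH] c H /=; first by rewrite addbb.
rewrite IH; last by move=> z zq; apply: H; right.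
have [_ yc] := H c (or_introl erefl).
have [xd yd] := H d (or_intror (or_introl erefl)).
rewrite /coray_step /ray_step xd yc yd; set u := step_sum _ _ _.
by case: u; case: (lx d v); case: (ly d v); case: (ly c v); case: (ly _ v).
Qed.

(* Summing [crossE] over the 18 pairs of independent edges of K_{3,3}, every
   ray term occurs twice, and what remains are the nine comparisons of two
   distinct [Q j], one for each pair of the [P i]. *)
Lemma K33_cross (P Q : 'I_3 -> T) (g : 'I_3 -> 'I_3 -> seq T) :
  (forall i j, last (P i) (g i j) = Q j) ->
  (forall i j k d, k != i -> List.In d (P i :: g i j) ->
    strictly_ordered (P k) d) ->
  (forall i j l d, l != j -> List.In d (P i :: g i j) ->
    strictly_ordered (Q l) d) ->
  exists i j k l, [/\ i != k, j != l & cross (P i) (g i j) (P k) (g k l)].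
Proof.
move=> lg HP HQ; apply: contrapT => H.
have E i j k l : i != k -> j != l ->
  ray (P i) (P k) (g k l) (+) ray (Q j) (P k) (g k l) (+)
  ((ray (P k) (P i) (g i j) (+) (ly (P i) (P k) (+) ly (Q j) (P k))) (+)
   (ray (Q l) (P i) (g i j) (+) (ly (P i) (Q l) (+) ly (Q j) (Q l)))) = false.
  move=> ik jl; apply: contra_notF H => X; exists i, j, k, l; split=> //.
  rewrite crossE !lg !corayE ?lg // => d.
    by apply: HQ; rewrite eq_sym.
  by apply: HP; rewrite eq_sym.
have EN i j k l : i != k -> j != l -> exists n,
  (ray (P i) (P k) (g k l) + ray (Q j) (P k) (g k l) +
  (ray (P k) (P i) (g i j) + (ly (P i) (P k) + ly (Q j) (P k)) +
   (ray (Q l) (P i) (g i j) + (ly (P i) (Q l) + ly (Q j) (Q l)))) = n.*2)%N.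
  move=> ik jl; have := E i j k l ik jl.
  set b1 := ray _ _ _; set b2 := ray _ _ _; set b3 := ray _ _ _.
  set b4 := ray _ _ _; set b5 := ly _ _; set b6 := ly _ _; set b7 := ly _ _.
  set b8 := ly _ _ => X.
  exists ((b1 + b2 + (b3 + (b5 + b6) + (b4 + (b7 + b8))))./2)%N.
  by rewrite even_halfK // !oddD !oddb X.
have ne (i j : 'I_3) : i != j -> (ly (Q i) (Q j) + ly (Q j) (Q i) = 1)%N.
  move=> ij; have [_ ->] : strictly_ordered (Q i) (Q j).
    apply: (HQ 0 j i (Q j) ij); rewrite -(lg 0 j).
    case: (g 0 j) => [|z s]; [by left|right].
    by elim: s z => [|z' s IH] z /=; [left|right; apply: IH].
  by case: (ly _ _).
exact: (K33_parity EN ne).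
Qed.
End CrossingParity.

Section TaggedPoints.
Variable R : realType.
Implicit Types a b c d : R * R * nat.

(* The tag breaks ties, so that points with different tags are in general
   position. *)
Definition tag_lx : rel (R * R * nat) :=
  fun a b => (a.1.1 < b.1.1) || ((a.1.1 == b.1.1) && (a.2 < b.2)%N).
Definition tag_ly : rel (R * R * nat) :=
  fun a b => (a.1.2 < b.1.2) || ((a.1.2 == b.1.2) && (a.2 < b.2)%N).

Lemma tag_ordered a b : a.2 != b.2 -> strictly_ordered tag_lx tag_ly a b.
Proof.
rewrite /strictly_ordered /tag_lx /tag_ly => ab; split.
  by case: (ltgtP a.1.1 b.1.1) => //= _; rewrite -leqNgt ltn_neqAle ab.
by case: (ltgtP a.1.2 b.1.2) => //= _; rewrite -leqNgt ltn_neqAle ab.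
Qed.

Lemma prod_norm_lt (u : R * R) (eta : R) :
  (`|u| < eta) = (- eta < u.1 < eta) && (- eta < u.2 < eta).
Proof. by rewrite prod_normE gt_max !ltr_norml. Qed.

(** If the horizontal part of the first step meets the vertical part of the second, the abscissa of
    [d] lies between those of [a] and [b], and the ordinate of [a] between those of [c] and [d]; so
    [a] and [d] are close. In the other case [b] and [c] are. *)
Lemma cross_step_close a b c d (eta : R) :
  cross_step tag_lx tag_ly a b c d ->
  `|a.1 - b.1| < eta -> `|c.1 - d.1| < eta ->
  `|a.1 - d.1| < eta \/ `|b.1 - c.1| < eta.
Proof.
have X u v : tag_lx u v -> u.1.1 <= v.1.1.
  by case/orP=> [/ltW|/andP[/eqP ->]].
have X' u v : ~~ tag_lx u v -> v.1.1 <= u.1.1.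
  by rewrite negb_or -leNgt => /andP[].
have Y u v : tag_ly u v -> u.1.2 <= v.1.2.
  by case/orP=> [/ltW|/andP[/eqP ->]].
have Y' u v : ~~ tag_ly u v -> v.1.2 <= u.1.2.
  by rewrite negb_or -leNgt => /andP[].
rewrite /cross_step !prod_norm_lt /=.
have ox u v z : tag_lx u z (+) tag_lx v z ->
    u.1.1 <= z.1.1 <= v.1.1 \/ v.1.1 <= z.1.1 <= u.1.1.
  case uz : (tag_lx u z); case vz : (tag_lx v z) => //= _.
    by left; apply/andP; split; [apply: X|apply: X'; rewrite vz].
  by right; apply/andP; split; [apply: X|apply: X'; rewrite uz].
have ox' u v z : tag_lx z u (+) tag_lx z v ->
    u.1.1 <= z.1.1 <= v.1.1 \/ v.1.1 <= z.1.1 <= u.1.1.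
  case uz : (tag_lx z u); case vz : (tag_lx z v) => //= _.
    by right; apply/andP; split; [apply: X'; rewrite vz|apply: X].
  by left; apply/andP; split; [apply: X'; rewrite uz|apply: X].
have oy u v z : tag_ly u z (+) tag_ly v z ->
    u.1.2 <= z.1.2 <= v.1.2 \/ v.1.2 <= z.1.2 <= u.1.2.
  case uz : (tag_ly u z); case vz : (tag_ly v z) => //= _.
    by left; apply/andP; split; [apply: Y|apply: Y'; rewrite vz].
  by right; apply/andP; split; [apply: Y|apply: Y'; rewrite uz].
have oy' u v z : tag_ly z u (+) tag_ly z v ->
    u.1.2 <= z.1.2 <= v.1.2 \/ v.1.2 <= z.1.2 <= u.1.2.
  case uz : (tag_ly z u); case vz : (tag_ly z v) => //= _.
    by right; apply/andP; split; [apply: Y'; rewrite vz|apply: Y].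
  by left; apply/andP; split; [apply: Y'; rewrite uz|apply: Y].
have sx u v : u (+) v -> u \/ v by case: u => //=; [left|right].
move/sx=> [/andP[/ox hx /oy hy]|/andP[/ox' hx /oy' hy]] h1 h2; [left|right].
  by case: hx => hx; case: hy => hy; lra.
by case: hx => hx; case: hy => hy; lra.
Qed.

End TaggedPoints.

Lemma finite_lower_bound (R : realType) (T : finType) (d : T -> R) :
  (forall q, 0 < d q) -> exists2 eta : R, 0 < eta & forall q, eta <= d q.
Proof.
move=> d0; have [q0 _|T0] := pickP (@predT T); last first.
  by exists 1 => // q; have := T0 q.
case: (arg_minP d (isT : predT q0)) => q _ H; exists (d q) => // q'.
exact: H.
Qed.

Section PlanarDrawing.
Variables (R : realType) (V : finType) (e : rel V).
Variables (pos : V -> R * R) (g : V -> V -> R -> R * R).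
Hypothesis drawing : plane_drawing e pos g.

Lemma disjoint_edges x y x' y' s t : e x y -> e x' y' ->
  x != x' -> x != y' -> y != x' -> y != y' ->
  s \in `[0, 1]%R -> t \in `[0, 1]%R -> g x y s <> g x' y' t.
Proof.
case: drawing => pinj _ _ src tgt _ av nc exy exy' n1 n2 n3 n4.
have I (u : R) : u \in `[0, 1]%R -> [\/ u = 0, u = 1 | u \in `]0, 1[%R].
  rewrite !in_itv /= => /andP[u0 u1].
  have [->|un0] := eqVneq u 0; first by constructor 1.
  have [->|un1] := eqVneq u 1; first by constructor 2.
  by constructor 3; rewrite !lt_neqAle u0 u1 un1 eq_sym un0.
case/I=> [->|->|sI]; case/I=> [->|->|tI];
  rewrite ?(src _ _ exy) ?(src _ _ exy') ?(tgt _ _ exy) ?(tgt _ _ exy').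
- by move/pinj/eqP; apply/negP.
- by move/pinj/eqP; apply/negP.
- by move/esym; apply: av.
- by move/pinj/eqP; apply/negP.
- by move/pinj/eqP; apply/negP.
- by move/esym; apply: av.
- exact: av.
- exact: av.
move/(nc _ _ _ _ _ _ exy exy' sI tI) => [[E _]|[E _]].
  by rewrite E eqxx in n1.
by rewrite E eqxx in n2.
Qed.

Let on_walk (S : pred V) (z : R * R) : Prop := exists x y t,
  [/\ e x y, S x, S y, t \in `[0, 1]%R & z = g x y t].

(** There are finitely many pairs of edges without common end, and the two arcs of each such pair
    have positive distance. *)
Lemma walk_separation : exists2 eta : R, 0 < eta &
  forall (S S' : pred V) z z', (forall x, S x -> ~~ S' x) ->
    on_walk S z -> on_walk S' z' -> eta <= `|z - z'|.
Proof.
pose ok (q : V * V * (V * V)) (d : R) := 0 < d /\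
  (e q.1.1 q.1.2 -> e q.2.1 q.2.2 -> q.1.1 != q.2.1 -> q.1.1 != q.2.2 ->
   q.1.2 != q.2.1 -> q.1.2 != q.2.2 -> forall s t, s \in `[0, 1]%R ->
   t \in `[0, 1]%R -> d <= `|g q.1.1 q.1.2 s - g q.2.1 q.2.2 t|).
have [q|d dok] := @choice _ _ ok.
  have [[[e1 e2] [[n1 n2] [n3 n4]]]|N] := pselect
    ((e q.1.1 q.1.2 /\ e q.2.1 q.2.2) /\
    ((q.1.1 != q.2.1 /\ q.1.1 != q.2.2) /\
    (q.1.2 != q.2.1 /\ q.1.2 != q.2.2))); last first.
    by exists 1; split=> // *; case: N.
  have [d d0 H] := disjoint_arcs_dist (drawing_continuous drawing e1)
    (drawing_continuous drawing e2)
    (fun s t => disjoint_edges e1 e2 n1 n2 n3 n4 (s := s) (t := t)).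
  by exists d; split=> // _ _ _ _ _ _.
have [eta eta0 H] := finite_lower_bound (fun q => (dok q).1).
exists eta => // S S' z z' SS' [x [y [s [exy Sx Sy sI ->]]]].
move=> [x' [y' [t [exy' Sx' Sy' tI ->]]]].
have ne u v : S u -> S' v -> u != v.
  by move=> Su; apply: contraL => /eqP <-; apply: SS'.
apply: le_trans (H ((x, y), (x', y'))) _.
by case: (dok ((x, y), (x', y'))) => _; apply=> //; apply: ne.
Qed.

Lemma walk_polyline (S : pred V) x p (eta : R) : 0 < eta ->
  path e x p -> all S (x :: p) -> p != [::] ->
  exists c : seq (R * R), last (pos x) c = pos (last x p) /\
    path (fun u v => `[< [/\ on_walk S u, on_walk S v & `|u - v| < eta] >])
      (pos x) c.
Proof.
move=> eta0; elim: p x => // y p IH x /= /andP[exy pp] /and3P[Sx Sy Sp] _.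
have [s [sI ls ps]] := arc_chain eta0 (drawing_continuous drawing exy).
pose c0 := map (g x y) s.
have lc0 : last (pos x) c0 = pos y.
  by rewrite -(drawing_source drawing exy) last_map ls (drawing_target drawing).
have pc0 : path (fun u v =>
    `[< [/\ on_walk S u, on_walk S v & `|u - v| < eta] >]) (pos x) c0.
  rewrite -(drawing_source drawing exy) path_map.
  have chain t0 s' : t0 \in `[0, 1]%R -> all (fun t => t \in `[0, 1]%R) s' ->
      path (fun u v => `|g x y u - g x y v| < eta) t0 s' ->
      path (relpre (g x y) (fun u v =>
        `[< [/\ on_walk S u, on_walk S v & `|u - v| < eta] >])) t0 s'.
    elim: s' t0 => //= t s' IHs t0 t0I /andP[tI sI'] /andP[tt ps'].
    apply/andP; split; last exact: IHs.
    by apply/asboolP; split=> //; [exists x, y, t0|exists x, y, t].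
  by apply: chain sI ps; rewrite in_itv /= lexx ler01.
have [p0|pn] := eqVneq p [::]; first by exists c0; rewrite p0.
have [|c [lc pc]] := IH y pp _ pn; first by rewrite /= Sy.
by exists (c0 ++ c); rewrite last_cat cat_path lc0 pc0.
Qed.

(** [K33_cross] forces two independent polylines to cross; since their steps are shorter than [eta],
    points of disjoint walks would come closer than [walk_separation] allows. *)
Lemma drawing_no_K33 : ~ K33_walks e.
Proof.
move=> [L [A [l [a [p [[Ll Aa] LA LL AA Hp]]]]]].
have [eta eta0 sep] := walk_separation.
pose S i j := predU (L i) (A j).
have pn i j : p i j != [::].
  apply/eqP => E; have [_ + _] := Hp i j; rewrite E /= => la.
  by have := LA i j (l i) (Ll i); rewrite la Aa.
have Hc (q : 'I_3 * 'I_3) : exists c : seq (R * R),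
    last (pos (l q.1)) c = pos (a q.2) /\
    path (fun u v => `[< [/\ on_walk (S q.1 q.2) u, on_walk (S q.1 q.2) v &
      `|u - v| < eta] >]) (pos (l q.1)) c.
  have [pp lp ap] := Hp q.1 q.2; rewrite -lp.
  exact: walk_polyline eta0 pp ap (pn _ _).
have [c cP] := choice Hc.
(* The six ends carry tags 0 to 5 and all other points tag 6. Each end is repeated with tag 6, by a
   step of length 0. *)
pose P (i : 'I_3) : R * R * nat := (pos (l i), i : nat).
pose Q (j : 'I_3) : R * R * nat := (pos (a j), (3 + j)%N).
pose tag (z : R * R) : R * R * nat := (z, 6%N).
pose G i j := rcons (map tag (pos (l i) :: c (i, j))) (Q j).
have tags i j d : List.In d (P i :: G i j) ->
    [\/ d.2 = i, d.2 = (3 + j)%N | d.2 = 6%N].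
  have rc s : List.In d (rcons (map tag s) (Q j)) ->
      d.2 = (3 + j)%N \/ d.2 = 6%N.
    elim: s => [|z s IH] /=; first by case=> // <-; left.
    by case=> [<-|/IH //]; right.
  case=> [<-|dG]; first by constructor 1.
  by have [] := rc (pos (l i) :: c (i, j)) dG; [constructor 2|constructor 3].
have [|||i [j [k [m [ik jm]]]]] := @K33_cross _ (@tag_lx R) (@tag_ly R) P Q G.
- by move=> i j; rewrite /G last_rcons.
- move=> i j k d ki /tags dt; apply: tag_ordered => /=.
  have := ltn_ord k; case: dt => -> //; move: ki;
    by rewrite -val_eqE /= => *; lia.
- move=> i j k d ki /tags dt; apply: tag_ordered => /=.
  have := ltn_ord k; have := ltn_ord i; case: dt => -> //; move: ki;
    by rewrite -val_eqE /= => *; lia.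
have SS : forall z, S i j z -> ~~ S k m z.
  move=> z /orP[Lz|Az]; apply/norP; split.
  - exact: LL ik Lz.
  - exact: LA Lz.
  - by apply: contraL Az; apply: LA.
  - exact: AA jm Az.
pose ok i j (u v : R * R * nat) := `[< [/\ on_walk (S i j) u.1,
  on_walk (S i j) v.1 & `|u.1 - v.1| < eta] >].
have pG i' j' : path (ok i' j') (P i') (G i' j').
  have [lc pc] := cP (i', j'); rewrite /= in lc pc.
  have [pp lp /allP ap] := Hp i' j'.
  have [os ot] :
      on_walk (S i' j') (pos (l i')) /\ on_walk (S i' j') (pos (a j')).
    have I0 : (0 : R) \in `[0, 1]%R by rewrite in_itv /= lexx ler01.
    have I1 : (1 : R) \in `[0, 1]%R by rewrite in_itv /= lexx ler01.
    split.
      case E : (p i' j') (pn i' j') => [|y q] // _.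
      move: pp; rewrite E /= => /andP[ey _]; exists (l i'), y, 0.
      by rewrite (drawing_source drawing ey); split=> //; apply: ap;
        rewrite E !inE eqxx ?orbT.
    case/lastP E : (p i' j') (pn i' j') => [|q y] // _.
    move: pp lp; rewrite E rcons_path last_rcons => /andP[_ ey] <-.
    exists (last (l i') q), y, 1.
    rewrite (drawing_target drawing ey); split=> //; apply: ap; rewrite E.
      by rewrite -rcons_cons mem_rcons inE mem_last orbT.
    by rewrite -rcons_cons mem_rcons inE eqxx.
  rewrite /G rcons_path /= path_map -andbA; apply/and3P; split.
  - by apply/asboolP; split=> //=; rewrite subrr normr0.
  - exact: pc.
  - by rewrite last_map lc; apply/asboolP; split=> //=; rewrite subrr normr0.
apply/negP; rewrite /cross step_sum0 //.
apply: sub_path (pG i j) => u v /asboolP[ou ov uv].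
rewrite step_sum0 //; apply: sub_path (pG k m) => u' v' /asboolP[ou' ov' uv'].
apply/negP => /cross_step_close /(_ uv uv') [lt|lt].
  by have := sep _ _ _ _ SS ou ov'; rewrite leNgt lt.
by have := sep _ _ _ _ SS ov ou'; rewrite leNgt lt.
Qed.

End PlanarDrawing.

(** * Codes for the clusters of one scale *)

Section GreedyCode.
Variables (I : finType) (T q : nat).
Local Notation code := {ffun 'I_T -> 'I_q.+1}.

Definition agree_on (W : {set 'I_T}) (f h : code) :=
  [forall t in W, f t == h t].

Lemma card_agree (W : {set 'I_T}) (h : code) :
  #|[set f | agree_on W f h]| = (q.+1 ^ (T - #|W|))%N.
Proof.
pose F t : pred 'I_q.+1 := if t \in W then pred1 (h t) else predT.
have -> : #|[set f | agree_on W f h]| = #|(family F : simpl_pred code)|.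
  apply: eq_card => f; rewrite inE; apply/forall_inP/familyP => H t.
    by rewrite /F; case: ifP => // /H.
  by move=> tW; have := H t; rewrite /F tW.
rewrite card_family foldrE big_map big_enum /=.
rewrite (eq_bigr (fun t => if t \in ~: W then q.+1 else 1%N)); last first.
  by move=> t _; rewrite /F inE; case: ifP => _; rewrite ?card1 ?card_ord.
rewrite -big_mkcond prod_nat_const.
have := cardsC W; rewrite card_ord => E.
have -> : (T - #|W|)%N = #|~: W|.
  apply/eqP; rewrite -(eqn_add2l #|W|) E subnKC //.
  by rewrite -[leqRHS]card_ord max_card.
by congr (_ ^ _)%N; apply: eq_card => t.
Qed.

Lemma exists_avoiding (Q : eqType) (B : Q -> {set code}) (s : seq Q) :
  (\sum_(v <- s) #|B v| < q.+1 ^ T)%N ->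
  exists f : code, forall v, v \in s -> f \notin B v.
Proof.
move=> H; apply: contrapT => nf; move: H; apply/negP; rewrite -leqNgt.
have full : [set: code] \subset \bigcup_(v <- s) B v.
  apply/fintype.subsetP => f _; apply: contra_notT nf => fB; exists f => v vs.
  by apply: contra fB => fv; rewrite (big_rem v) //= inE fv.
have := subset_leq_card full; rewrite cardsT card_ffun !card_ord.
move/leq_trans; apply.
elim: s {nf full} => [|v s IH]; first by rewrite !big_nil cards0.
rewrite !big_cons; apply: leq_trans (leq_card_setU _ _) _.
by rewrite leq_add2l.
Qed.

Variables (sz M : I -> nat) (N : rel I) (W : I -> {set 'I_T}).
Hypotheses (Nsym : symmetric N) (Nirr : irreflexive N).
Hypothesis sz_window : forall u v, N u v ->
  (0 < sz u)%N /\ (4 * M u <= sz u * q.+1 ^ #|W u|)%N.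
Hypothesis sz_near : forall u v, N u v ->
  (\sum_(v' | N u v') sz v' <= M u)%N /\ (\sum_(v' | N u v') sz v' <= M v)%N.

(* Codewords are chosen in order of decreasing [sz]; for each new one the
   earlier neighbours forbid at most half of all words. *)
Lemma greedy_code : exists h : I -> code, forall u v, N u v ->
  ~~ agree_on (W u) (h u) (h v).
Proof.
have H (s : seq I) : uniq s -> sorted (fun u v => sz u <= sz v)%N s ->
    exists h : I -> code, forall u v, u \in s -> v \in s -> u != v -> N u v ->
      ~~ agree_on (W u) (h u) (h v).
  elim: s => [|u s IH]; first by exists (fun=> [ffun=> ord0]).
  rewrite [uniq _]/= => /andP[us uniqs] su.
  have [h hP] := IH uniqs (path_sorted su).
  have us_le v : v \in s -> (sz u <= sz v)%N.
    have tr : transitive (fun u v => sz u <= sz v)%N.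
      by move=> ? ? ?; apply: leq_trans.
    by move: su; rewrite /= (path_sortedE tr) => /andP[/allP al _] /al.
  (* Both windows are taken into account, because the conclusion applies to [N u v] and to
     [N v u]. *)
  pose B v : {set code} := if N u v then
    [set f | agree_on (W u) f (h v)] :|: [set f | agree_on (W v) f (h v)]
    else finset.set0.
  have [|f fP] := @exists_avoiding _ B s.
    have [|nN] := boolP (has (N u) s); last first.
      rewrite big_seq big1 ?expn_gt0 // => v vs; rewrite /B.
      by rewrite (negbTE (hasPn nN v vs)) cards0.
    case/hasP => v0 v0s Nuv0.
    have [szu wu] := sz_window Nuv0.
    pose S := (\sum_(v | N u v) sz v)%N; have [SM _] := sz_near Nuv0.
    pose s' := [seq v <- s | N u v].
    have us' : uniq s' by rewrite filter_uniq.
    have Ss' : (\sum_(v <- s') sz v <= S)%N.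
      rewrite big_filter; rewrite /S [leqRHS](bigID (mem s)) /=.
      rewrite -big_filter -[X in (_ <= X + _)%N]big_filter.
      rewrite (perm_big [seq i <- index_enum I | N u i && (i \in s)]) /=;
        first exact: leq_addr.
      apply: uniq_perm; rewrite ?filter_uniq ?index_enum_uniq // => v.
      by rewrite !mem_filter mem_index_enum andbT.
    have Spos : (0 < S)%N.
      have v0s' : v0 \in s' by rewrite mem_filter Nuv0.
      apply: leq_trans Ss'; rewrite (big_rem v0) //= ltn_addr //.
      exact: leq_trans szu (us_le _ v0s).
    have sumB : (\sum_(v <- s) #|B v| <= \sum_(v <- s') q.+1 ^ (T - #|W u|) +
        \sum_(v <- s') q.+1 ^ (T - #|W v|))%N.
      rewrite -big_split /= big_filter [leqRHS]big_mkcond /=.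
      apply: leq_sum => v _.
      rewrite /B; case: ifP => _; last by rewrite cards0.
      by apply: leq_trans (leq_card_setU _ _) _; rewrite !card_agree.
    have qT (A : {set 'I_T}) : (q.+1 ^ T = q.+1 ^ #|A| * q.+1 ^ (T - #|A|))%N.
      by rewrite -expnD subnKC // -[leqRHS]card_ord max_card.
    (* Neighbours coded before [u] are at least as large as [u], so there are at most [M u / sz u]
       of them. *)
    have b1 : (4 * (\sum_(v <- s') q.+1 ^ (T - #|W u|)) <= q.+1 ^ T)%N.
      have Mu : (0 < M u)%N by apply: leq_trans SM.
      rewrite -(leq_pmul2l Mu) mulnA big_const_seq iter_addn_0 count_predT.
      rewrite (qT (W u)); set X := (_ ^ (T - _))%N; set Y := (_ ^ _)%N.
      have szS : (size s' * sz u <= M u)%N.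
        apply: leq_trans SM; apply: leq_trans Ss'.
        rewrite mulnC -sum1_size big_distrr /= big_seq [leqRHS]big_seq.
        apply: leq_sum => v; rewrite mem_filter => /andP[_ /us_le].
        by rewrite muln1.
      apply: leq_trans (_ : (size s' * (sz u * Y) * X <= _)%N).
        rewrite [(X * _)%N]mulnC mulnA leq_mul2r; apply/orP; right.
        by rewrite mulnC leq_mul2l [(M u * 4)%N]mulnC wu orbT.
      by rewrite !mulnA leq_mul2r leq_mul2r szS !orbT.
    (* Here each neighbour [v] is charged by its own size: it forbids at most the fraction
       [sz v / (4 * M v)] of all words, and the sizes add up to at most [S <= M v]. *)
    have b2 : (4 * (\sum_(v <- s') q.+1 ^ (T - #|W v|)) <= q.+1 ^ T)%N.
      rewrite -(leq_pmul2l Spos) mulnA big_distrr /=.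
      apply: leq_trans (_ : (\sum_(v <- s') sz v * q.+1 ^ T <= _)%N);
        last first.
        by rewrite -big_distrl leq_mul2r Ss' orbT.
      rewrite big_seq [leqRHS]big_seq; apply: leq_sum => v.
      rewrite mem_filter => /andP[Nuv _]; have [_ SMv] := sz_near Nuv.
      have [_ wv] : (0 < sz v)%N /\ (4 * M v <= sz v * q.+1 ^ #|W v|)%N.
        by apply: (@sz_window v u); rewrite Nsym.
      rewrite (qT (W v)) mulnA leq_mul2r; apply/orP; right.
      by apply: leq_trans wv; rewrite mulnC leq_mul2l SMv.
    have : (0 < q.+1 ^ T)%N by rewrite expn_gt0.
    move: b1 b2 sumB; set a := (\sum_(_ <- _) _)%N.
    set b := (\sum_(_ <- _) _)%N.
    by set c := (\sum_(_ <- _) _)%N; set d := (_ ^ _)%N; lia.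
  exists (fun v => if v == u then f else h v) => a b.
  have fv v : v \in s -> N u v ->
      ~~ agree_on (W u) f (h v) && ~~ agree_on (W v) f (h v).
    by move=> vs Nuv; have := fP v vs; rewrite /B Nuv !inE negb_or.
  have agree_sym A (f1 f2 : code) : agree_on A f1 f2 = agree_on A f2 f1.
    by apply: eq_forallb => t; rewrite eq_sym.
  rewrite !inE; case: (eqVneq a u) => [->|au] /=;
    case: (eqVneq b u) => [->|bu] //=; rewrite ?eqxx //.
  - by move=> _ bs _ Nub; case/andP: (fv b bs Nub).
  - move=> as_ _ _; rewrite Nsym => Nua; rewrite agree_sym.
    by case/andP: (fv a as_ Nua).
  - exact: hP.
have tot : total (fun u v => sz u <= sz v)%N by move=> u v; apply: leq_total.
have [||h hP] := H (sort (fun u v => sz u <= sz v)%N (enum I)).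
- by rewrite sort_uniq enum_uniq.
- exact: sort_sorted.
exists h => u v Nuv; apply: hP; rewrite ?mem_sort ?mem_enum //.
by apply: contraTneq Nuv => ->; rewrite Nirr.
Qed.

End GreedyCode.

Lemma card_window (m a b : nat) : (b <= m)%N ->
  (b - a <= #|[set t : 'I_m.+1 | (a < t <= b)%N]|)%N.
Proof.
move=> bm; pose f (i : 'I_(b - a)) : 'I_m.+1 := inord (a + i.+1).
have fE i : f i = (a + i.+1)%N :> nat.
  by rewrite /f inordK //; have := ltn_ord i; lia.
have inj : injective f.
  by move=> i j /(congr1 val); rewrite /= !fE => ?; apply: val_inj => /=; lia.
rewrite -[leqLHS]card_ord -(card_imset _ inj); apply: subset_leq_card.
apply/fintype.subsetP => _ /imsetP[i _ ->]; rewrite inE fE.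
by have := ltn_ord i; lia.
Qed.

Section ScaleCode.
Variables (R : realType) (V : finType) (d : V -> V -> R).
Hypotheses (d0 : forall x, d x x = 0) (dC : forall x y, d x y = d y x).
Hypothesis dT : forall x y z, d x z <= d x y + d y z.

Definition ball_card (x : V) (r : R) : nat := #|[set z | d x z <= r]|.

Lemma ball_card_sub x y r r' : d x y + r <= r' ->
  (ball_card y r <= ball_card x r')%N.
Proof.
move=> H; apply: subset_leq_card; apply/fintype.subsetP => z.
rewrite !inE => dyz.
by have := dT x y z; lra.
Qed.

Let m := trunc_log 2 #|V|.

(** The greedy code is applied to the clusters, with windows running from the logarithm of the size
    of a cluster to that of its neighbourhood. The padding of [x] compares the lower end with the
    small ball, and the diameter bound compares the upper end with the large one. *)
Lemma scale_code (K r : R) (P : V -> V) : 1 <= K -> 0 < r ->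
  (forall x y, P x = P y -> d x y <= K * r) ->
  exists h : V -> {ffun 'I_m.+1 -> 'I_16}, forall x y,
    (forall z, d x z <= r -> P x = P z) -> P x != P y -> d x y <= 2 * K * r ->
    (2 * ball_card x r <= ball_card x ((2 * K + 1) * r))%N ->
    exists t : 'I_m.+1, [/\ h (P x) t != h (P y) t,
      (ball_card x r < 2 ^ t)%N & (2 ^ t <= ball_card x (7 * K * r))%N].
Proof.
move=> K1 r0 diam.
have rK : r <= K * r by rewrite ler_peMl // ltW.
have [Kr KrE] : exists Kr, Kr = K * r by exists (K * r).
rewrite -KrE in rK diam; have Kr0 : 0 < Kr by lra.
pose N u v := (u != v) &&
  [exists x, exists y, [&& P x == u, P y == v & d x y <= 2 * Kr]].
have NP u v : N u v ->
    u != v /\ exists x y, [/\ P x = u, P y = v & d x y <= 2 * Kr].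
  case/andP=> uv /existsP[x /existsP[y /and3P[/eqP xu /eqP yv dxy]]].
  by split=> //; exists x, y.
have NI x y : P x != P y -> d x y <= 2 * Kr -> N (P x) (P y).
  move=> ne dxy; rewrite /N ne.
  apply/existsP; exists x; apply/existsP; exists y.
  by rewrite !eqxx.
have Nsym : symmetric N.
  have H u v : N u v -> N v u.
    move=> /NP[uv [x [y [xu yv dxy]]]].
    by rewrite -xu -yv NI // 1?dC // xu yv eq_sym.
  by move=> u v; apply/idP/idP; apply: H.
have Nirr : irreflexive N by move=> u; rewrite /N eqxx.
pose sz u := #|[set z | P z == u]|.
(* From a point of a cluster, [6 = 2 + 1 + 2 + 1] reaches across an adjacent cluster to all points
   of the clusters adjacent to that one. *)
pose nbhd u := [set z | [exists x, (P x == u) && (d x z <= 6 * Kr)]].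
pose M u := #|nbhd u|.
have inN x z : d x z <= 6 * Kr -> z \in nbhd (P x).
  by move=> dxz; rewrite inE; apply/existsP; exists x; rewrite eqxx.
have M_ball x : (M (P x) <= ball_card x (7 * Kr))%N.
  apply: subset_leq_card; apply/fintype.subsetP => z.
  rewrite !inE => /existsP[y /andP[/eqP /esym /diam dxy dyz]].
  by have := dT x y z; lra.
pose lam u := trunc_log 2 (M u).
(* The cap at [(lam u).-1] keeps the window nonempty even if the cluster fills most of its
   neighbourhood. *)
pose low u := minn (trunc_log 2 (sz u)) (lam u).-1.
pose W u : {set 'I_m.+1} := [set t : 'I_m.+1 | (low u < t <= lam u)%N].
have lam_m u : (lam u <= m)%N by apply: leq_trunc_log; apply: max_card.
have sumsz (Q : pred V) : (\sum_(v | Q v) sz v = #|[set z | Q (P z)]|)%N.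
  rewrite -sum1_card [RHS](partition_big P Q) /=;
    last by move=> z; rewrite ?inE.
  apply: eq_bigr => v Qv; rewrite /sz -sum1_card; apply: eq_bigl => z.
  by rewrite !inE; case: eqP => [->|]; rewrite ?Qv ?andbF.
have win u v : N u v -> (0 < sz u)%N /\ (4 * M u <= sz u * 16 ^ #|W u|)%N.
  move=> /NP[uv [x [y [xu yv dxy]]]].
  have szu : (0 < sz u)%N by apply/card_gt0P; exists x; rewrite inE xu.
  split=> //; have M2 : (1 < M u)%N.
    have xy : x != y by apply: contraNneq uv => E; rewrite -xu -yv E.
    have -> : 2%N = #|[set x; y]| by rewrite cards2 xy.
    apply: subset_leq_card; apply/fintype.subsetP => z.
    by rewrite !inE => /orP[] /eqP ->; apply/existsP; exists x;
      rewrite xu eqxx ?d0 /=; lra.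
  have l1 : (0 < lam u)%N by rewrite trunc_log_gt0.
  have Ml : (M u < 2 ^ (lam u).+1)%N by apply: trunc_log_ltn.
  have szl : (2 ^ low u <= sz u)%N.
    apply: leq_trans (trunc_logP (isT : 1 < 2)%N szu).
    by rewrite leq_exp2l // geq_minl.
  have jW : (lam u - low u <= #|W u|)%N by apply: card_window.
  have lowl : (low u <= (lam u).-1)%N by rewrite geq_minr.
  apply: leq_trans (leq_mul szl (leq_pexp2l (isT : 0 < 16)%N jW)).
  (* As [lam - low >= 1], the exponent [low + 4 * (lam - low)] is at least [lam + 3], which bounds
     [4 * M u]; so 16 letters suffice. *)
  rewrite -[16%N]/(2 ^ 4)%N -expnM -expnD.
  apply: leq_trans (leq_mul (leqnn 4) (ltnW Ml)) _.
  by rewrite -[4%N]/(2 ^ 2)%N -expnD leq_exp2l //; lia.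
have near u v : N u v -> (\sum_(v' | N u v') sz v' <= M u)%N /\
    (\sum_(v' | N u v') sz v' <= M v)%N.
  move=> /NP[uv [x [y [xu yv dxy]]]]; rewrite sumsz.
  split; apply: subset_leq_card; apply/fintype.subsetP => z;
    rewrite inE => /NP[_].
    move=> [x' [y' [<- /diam dyz dxy']]]; apply: inN.
    by have := dT x' y' z; lra.
  move=> [x' [y' [x'u /diam dyz dxy']]]; rewrite -yv; apply: inN.
  have dxx : d x x' <= Kr by apply: diam; rewrite xu.
  have := dT y x z; have := dT x x' z; have := dT x' y' z; have := dC y x.
  by lra.
have [h hP] := greedy_code Nsym Nirr win near.
exists h => x y pad Pxy dxy big.
have Nxy : N (P x) (P y) by apply: NI => //; rewrite KrE mulrA.
have := hP _ _ Nxy; rewrite negb_forall_in => /exists_inP[t].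
rewrite inE => /andP[lt tl] ht; exists t; split=> //; last first.
  rewrite -mulrA -KrE; apply: leq_trans (M_ball x).
  apply: leq_trans (trunc_logP (isT : 1 < 2)%N _).
    by rewrite leq_exp2l.
  by apply/card_gt0P; exists x; apply: inN; rewrite d0; lra.
have bx : (0 < ball_card x r)%N.
  by apply/card_gt0P; exists x; rewrite inE d0 ltW.
apply: leq_trans (trunc_log_ltn _ (isT : 1 < 2)%N) _; rewrite leq_exp2l //.
apply: leq_ltn_trans lt; rewrite leq_min; apply/andP; split.
  apply: leq_trunc_log; apply: subset_leq_card; apply/fintype.subsetP => z.
  by rewrite !inE => /pad ->.
(* The doubling of the ball takes care of the cap in [low]. *)
have big' : ((ball_card x r).*2 <= M (P x))%N.
  rewrite -mul2n; apply: leq_trans big _; apply: subset_leq_card.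
  apply/fintype.subsetP => z; rewrite inE => dxz; apply: inN.
  by move: dxz; rewrite mulrDl mul1r -mulrA -KrE => *; lra.
rewrite -ltnS -trunc_log2_double // prednK; first exact: leq_trunc_log.
by rewrite trunc_log_gt0 /=; lia.
Qed.

End ScaleCode.

(** * Embedding into the max norm *)

Lemma last_true (P : nat -> bool) (L : nat) : P 0%N -> ~~ P L ->
  exists i, [/\ (i < L)%N, P i & ~~ P i.+1].
Proof.
elim: L => [|L IH] P0; first by rewrite P0.
have [PL nP|nP _] := boolP (P L); first by exists L.
by have [i [iL Pi nPi]] := IH P0 nP; exists i; split=> //; apply: leqW.
Qed.

Section TruncatedDistance.
Variables (R : realType) (V : finType) (d : V -> V -> R).
Hypotheses (d0 : forall x, d x x = 0) (dC : forall x y, d x y = d y x).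
Hypothesis dT : forall x y z, d x z <= d x y + d y z.

Let d_ge0 x y : 0 <= d x y.
Proof. by have := dT x y x; rewrite d0 (dC y x); lra. Qed.

(** The initial value [r] of the minimum is both the cap and the value when the complement of [Z] is
    empty. *)
Definition dcap (r : R) (Z : pred V) (z : V) : R :=
  \big[Num.min/r]_(v | ~~ Z v) d z v.

Lemma dcap_le r Z z : dcap r Z z <= r.
Proof. exact: bigmin_le_id. Qed.

Lemma dcap_out r Z z : ~~ Z z -> dcap r Z z <= 0.
Proof. by move=> nZ; rewrite -(d0 z); apply: bigmin_le_cond. Qed.

Lemma dcap_in r (Z : pred V) z : (forall v, d z v < r -> Z v) ->
  r <= dcap r Z z.
Proof.
move=> H; apply/bigmin_geP; split=> // v nZ; rewrite leNgt.
by apply: contra nZ; apply: H.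
Qed.

Lemma dcap_lip r Z x y : dcap r Z x <= dcap r Z y + d x y.
Proof.
rewrite -lerBlDr; apply/bigmin_geP; split=> [|v nZ].
  by have := dcap_le r Z x; have := d_ge0 x y; lra.
have : dcap r Z x <= d x v by apply: bigmin_le_cond.
by have := dT x y v; lra.
Qed.

Lemma bigmax_dcap_lip (L : nat) (r : nat -> R) (Z : nat -> pred V) x y :
  `|\big[Num.max/0]_(l < L) dcap (r l) (Z l) x -
    \big[Num.max/0]_(l < L) dcap (r l) (Z l) y| <= d x y.
Proof.
have H u v : \big[Num.max/0]_(l < L) dcap (r l) (Z l) u <=
    \big[Num.max/0]_(l < L) dcap (r l) (Z l) v + d u v.
  apply/bigmax_leP; split=> [|l _].
    by rewrite addr_ge0 // bigmax_ge_id.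
  apply: le_trans (dcap_lip _ _ u v) _; rewrite lerD2r.
  exact: (le_bigmax _ (fun l : 'I_L => dcap (r l) (Z l) v)).
have := H x y; have := H y x; rewrite (dC y x) => *.
by rewrite ler_norml; apply/andP; split; lra.
Qed.

End TruncatedDistance.

Lemma rV_norm_leP (R : realType) (k : nat) (u : 'rV[R]_k) (c : R) : 0 <= c ->
  (forall i, `|u 0 i| <= c) -> `|u| <= c.
Proof.
move=> c0 H; rewrite /Num.norm /= mx_normrE; apply/bigmax_leP; split=> // i _.
by rewrite ord1.
Qed.

Lemma rV_norm_ge (R : realType) (k : nat) (u : 'rV[R]_k) i : `|u 0 i| <= `|u|.
Proof.
rewrite [leRHS]/Num.norm /= mx_normrE.
exact: (le_bigmax _ (fun ij : 'I_1 * 'I_k => `|u ij.1 ij.2|) (0, i)).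
Qed.

Section Embedding.
Variables (R : realType) (V : finType) (d : V -> V -> R).
Hypotheses (d0 : forall x, d x x = 0) (dC : forall x y, d x y = d y x).
Hypothesis dT : forall x y z, d x z <= d x y + d y z.
Hypothesis dpos : forall x y, x != y -> 0 < d x y.
Variables (C : finType) (K : R) (b : nat).
Hypotheses (K2 : 2 <= K) (Kb : 18 * K <= 2 ^+ b).
Hypothesis partitions : forall r : R, 0 < r -> exists P : C -> V -> V,
  (forall c x y, P c x = P c y -> d x y <= K * r) /\
  (forall x, exists c, forall y, d x y <= r -> P c x = P c y).

Let m := trunc_log 2 #|V|.

(** Each coordinate is a maximum over one residue class of scales modulo [b]. Consecutive scales of
    a class differ by the factor [2 ^ b >= 18 * K], so that larger and smaller scales do not disturb
    the one that separates a pair. *)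
Theorem linf_embedding : exists f : V -> 'rV[R]_(b * #|C| * m.+1 * 16),
  forall x y, d x y / (8 * K) <= `|f x - f y| <= d x y.
Proof.
have K0 : 0 < K by have := K2; lra.
have K1 : 1 <= K by have := K2; lra.
have d_ge0 x y : 0 <= d x y by have := dT x y x; rewrite d0 (dC y x); lra.
have [eta eta0 etaP] : exists2 eta : R, 0 < eta & forall q : V * V,
    eta <= if q.1 == q.2 then 1 else d q.1 q.2.
  by apply: finite_lower_bound => q; case: eqVneq => // ne; rewrite dpos.
(* [K * r 0] is [eta / 2], less than every positive distance, and [K * r L] will bound all
   distances; hence each pair has a scale with [K * r i < d x y <= 2 * K * r i]. *)
pose r (i : nat) : R := eta / (2 * K) * 2 ^+ i.
have r_gt0 i : 0 < r i by rewrite mulr_gt0 ?exprn_gt0 // divr_gt0 // mulr_gt0.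
have rS i : r i.+1 = 2 * r i by rewrite /r exprSr; ring.
have r_mono i j : (i <= j)%N -> r i <= r j.
  by move=> ij; rewrite ler_pM2l ?ler_eXn2l ?ltr1n // divr_gt0 // mulr_gt0.
have rD i j : r (i + j)%N = r i * 2 ^+ j by rewrite /r exprD mulrA.
have [L LP] : exists L, forall x y, d x y <= K * r L.
  pose D := \big[Num.max/0]_(q : V * V) d q.1 q.2.
  have KE : K * r 0%N = eta / 2 by rewrite /r expr0; field; lra.
  have e2 : 0 < eta / 2 by rewrite divr_gt0.
  exists (Num.truncn (D / (eta / 2))).+1 => x y.
  apply: le_trans (le_bigmax _ (fun q : V * V => d q.1 q.2) (x, y)) _.
  set n := (Num.truncn _).+1.
  rewrite -/D -[n]add0n rD mulrA KE mulrC -ler_pdivrMr //.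
  apply: le_trans (ltW (truncnS_gt _)) _; rewrite -/n.
  by rewrite -natrX ler_nat; apply: ltnW; apply: ltn_expl.
have [P PP] := choice (fun i => partitions (r_gt0 i)).
have [h hP] := choice (fun ic : nat * C => scale_code d0 dC dT
  K1 (r_gt0 ic.1) ((PP ic.1).1 ic.2)).
(* The condition on balls makes [t] inactive at a point for all scales much
   larger than the one whose mass is about [2 ^ t]; smaller scales are harmless
   since the truncation level is proportional to the scale. *)
pose Z i c (t : 'I_m.+1) (al : 'I_16) : pred V := fun v =>
  (h (i, c) (P i c v) t == al) && (ball_card d v (r i / 2) < 2 ^ t)%N.
pose F (q : 'I_b * C * 'I_m.+1 * 'I_16) (z : V) : R :=
  \big[Num.max/0]_(l < L)
    dcap d (r (l * b + q.1.1.1)%N / 2)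
      (Z (l * b + q.1.1.1)%N q.1.1.2 q.1.2 q.2) z.
have kE : #|{: 'I_b * C * 'I_m.+1 * 'I_16}| = (b * #|C| * m.+1 * 16)%N.
  by rewrite !card_prod !card_ord.
pose f z : 'rV[R]_(b * #|C| * m.+1 * 16) :=
  \row_i F (enum_val (cast_ord (esym kE) i)) z.
have f_ge q x y : `|F q x - F q y| <= `|f x - f y|.
  apply: le_trans (rV_norm_ge _ (cast_ord kE (enum_rank q))).
  by rewrite !mxE cast_ordK enum_rankK.
have b0 : (0 < b)%N.
  by rewrite lt0n; apply/eqP => E; move: Kb; rewrite E expr0; have := K2; lra.
have sep x y i : (i < L)%N -> K * r i < d x y -> d x y <= 2 * K * r i ->
    (ball_card d x (r i) <= ball_card d y (r i))%N ->
    d x y / (8 * K) <= `|f x - f y|.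
  move=> iL lo hi le; have r0 := r_gt0 i.
  have rK : 2 * r i <= K * r i by rewrite ler_pM2r.
  (* The balls about [x] and [y] are disjoint because [d x y > K * r i >= 2 * r i], and the one
     about [y] is not smaller. *)
  have big : (2 * ball_card d x (r i) <= ball_card d x ((2 * K + 1) * r i))%N.
    rewrite mul2n -addnn; apply: leq_trans (leq_add (leqnn _) le) _.
    rewrite /ball_card -cardsUI (_ : _ :&: _ = finset.set0) ?cards0 ?addn0.
      apply: subset_leq_card; apply/fintype.subsetP => z.
      rewrite !inE mulrDl mul1r => /orP[dz|dz]; first by lra.
      by have := dT x y z; lra.
    apply/setP => z; rewrite !inE; apply/negP => /andP[dx dy].
    by have := dT x z y; rewrite (dC z y); lra.
  have [c pad] := (PP i).2 x.
  have Pxy : P i c x != P i c y.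
    by apply/negP => /eqP /((PP i).1 c); lra.
  have [t [ht tlo thi]] := hP (i, c) x y pad Pxy hi big.
  pose j : 'I_b := Ordinal (ltn_pmod i b0).
  have l0L : (i %/ b < L)%N by apply: leq_ltn_trans (leq_div i b) iL.
  pose q := (j, c, t, h (i, c) (P i c x) t).
  have iE : (i %/ b * b + j)%N = i by rewrite /= -divn_eq.
  have Fx : r i / 2 <= F q x.
    apply: le_trans (le_bigmax _ (fun l : 'I_L => dcap d (r (l * b + j)%N / 2)
      (Z (l * b + j)%N c t q.2) x) (Ordinal l0L)).
    rewrite [in leRHS]/= iE; apply: dcap_in => v dxv.
    rewrite /Z -(pad v) ?eqxx /=; last by lra.
    by apply: leq_ltn_trans tlo; apply: (ball_card_sub dT); lra.
  (* Smaller scales of the class are capped at [r i / 4], at larger ones [t] is inactive at [y], and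
     at scale [i] the letters differ. *)
  have Fy : F q y <= r i / 4.
    apply/bigmax_leP; split=> [|l _]; first by lra.
    rewrite /=; case: (ltngtP l (i %/ b)%N) => [ll|ll|->].
    - apply: le_trans (dcap_le _ _ _ _) _.
      have : r (l * b + i %% b).+1 <= r i.
        apply: r_mono; rewrite [leqRHS](divn_eq i b) -addSn leq_add2r.
        apply: leq_trans (leq_mul ll (leqnn b)).
        by rewrite mulSn -add1n leq_add2r.
      by rewrite rS; lra.
    (* Here [18 = 2 * (2 + 7)]: the ball of radius [7 * K * r i] about [x] lies in the one of radius
       [9 * K * r i] about [y], and [9 * K * r i] is at most half the next scale of the class. *)
    - apply: le_trans (dcap_out d0 _ _) _; last by lra.
      rewrite /Z negb_and -leqNgt; apply/orP; right.
      apply: leq_trans thi _; apply: (ball_card_sub dT); rewrite (dC y x).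
      have : r (i + b)%N <= r (l * b + i %% b)%N.
        apply: r_mono; rewrite [X in (X + b)%N](divn_eq i b) addnAC leq_add2r.
        by apply: leq_trans (leq_mul ll (leqnn b)); rewrite mulSn addnC.
      have : r i * (18 * K) <= r (i + b)%N by rewrite rD ler_pM2l.
      by lra.
    apply: le_trans (dcap_out d0 _ _) _; last by lra.
    by rewrite -divn_eq /Z negb_and eq_sym ht.
  apply: le_trans (f_ge q x y); apply: le_trans (ler_norm _).
  apply: le_trans (_ : r i / 4 <= _); last by lra.
  rewrite ler_pdivrMr ?mulr_gt0 //.
  have -> : r i / 4 * (8 * K) = 2 * K * r i by field.
  exact: hi.
exists f => x y; apply/andP; split; last first.
  apply: rV_norm_leP => // i; rewrite !mxE.
  set q := enum_val _.
  exact: (bigmax_dcap_lip d0 dC dT L (fun l => r (l * b + q.1.1.1)%N / 2)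
    (fun l => Z (l * b + q.1.1.1)%N q.1.1.2 q.1.2 q.2)).
have [->|xy] := eqVneq x y; first by rewrite d0 mul0r normr_ge0.
have [||i [iL lo hi]] := @last_true (fun i => K * r i < d x y) L.
- have := etaP (x, y); rewrite /= (negbTE xy).
  have -> : K * r 0%N = eta / 2 by rewrite /r expr0; field; lra.
  by lra.
- by rewrite -leNgt.
have hi' : d x y <= 2 * K * r i.
  by move: hi; rewrite -leNgt rS mulrA (mulrC K).
case/orP: (leq_total (ball_card d x (r i)) (ball_card d y (r i))) => le.
  exact: sep iL lo hi' le.
by rewrite dC distrC; apply: sep iL _ _ le; rewrite dC.
Qed.

End Embedding.

(** The least value is the quotient of the largest and the smallest ratio [dY / dX] over pairs of
    distinct points; both are attained, [V] being finite with two points. *)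
Lemma least_distortion (R : realType) (V : finType) (Y : Type)
    (dX : V -> V -> R) (dY : Y -> Y -> R) (f : V -> Y) (x0 y0 : V) :
  x0 != y0 -> (forall x, dX x x = 0) -> (forall x, dY (f x) (f x) = 0) ->
  (forall x y, x != y -> 0 < dX x y) ->
  (forall x y, x != y -> 0 < dY (f x) (f y)) ->
  exists D, is_distortion dX dY f D.
Proof.
move=> n0 dX0 dY0 dXp dYp.
pose a (q : V * V) := dY (f q.1) (f q.2) / dX q.1 q.2.
have ap x y : x != y -> 0 < a (x, y) by move=> xy; rewrite divr_gt0 ?dXp ?dYp.
pose Q (q : V * V) := q.1 != q.2.
have Q0 : Q (x0, y0) by [].
case: (arg_maxP a Q0) => -[xM yM] QM aM.
case: (arg_minP a Q0) => -[xm ym] Qm am.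
have pM := ap _ _ QM; have pm := ap _ _ Qm.
exists (a (xM, yM) / a (xm, ym)); split.
  split; first by rewrite divr_gt0.
  exists (a (xM, yM)); split=> // x y.
  have [->|xy] := eqVneq x y; first by rewrite dX0 dY0 !mulr0.
  have dp := dXp _ _ xy.
  rewrite invf_div mulrCA mulfV ?gt_eqF // mulr1.
  split; first by rewrite -ler_pdivlMr //; apply: (am (x, y)).
  by rewrite -ler_pdivrMr //; apply: (aM (x, y)).
move=> K' [K0 [c [c0 H]]].
have lM : a (xM, yM) <= c by rewrite ler_pdivrMr ?dXp //; case: (H xM yM).
have lm : c * K'^-1 <= a (xm, ym).
  by rewrite ler_pdivlMr ?dXp //; case: (H xm ym).
rewrite ler_pdivrMr //; apply: le_trans lM _.
by rewrite mulrC -ler_pdivrMr.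
Qed.

Theorem theorem1p3 (R : realType) :
  exists C1 C2 : R, 0 < C1 /\ 0 < C2 /\
    forall (n : nat) (V : finType) (e : rel V) (w : V -> V -> R),
      (2 <= n)%N -> #|V| = n ->
      simple_graph e -> connected_graph e -> planar R e ->
      positive_weights e w ->
      exists k : nat, k%:R <= C1 * ln (n%:R : R) /\
        exists (f : V -> 'rV[R]_k) (D : R),
          injective f /\
          is_distortion (sp_dist e w) (@linf_dist R k) f D /\
          D <= C2.
Proof.
have ln2 : 0 < ln 2 :> R by rewrite ln_gt0 // ltr1n.
(* 11 residue classes, as [2 ^ 11 >= 18 * 84]; 8 choices of shifts; 16 letters; and 2 because
   [m + 1 <= 2 * m] for the logarithm [m >= 1]. *)
have [c cE] : exists c, c = (11 * 8 * 16 * 2)%N by exists (11 * 8 * 16 * 2)%N.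
have [K KE] : exists K : R, K = 84 by exists 84.
have K2 : 2 <= K by rewrite KE ler_nat.
have K0 : 0 < K by lra.
exists (c%:R / ln 2), (8 * K); split; first by rewrite divr_gt0 // cE ltr0n.
split; first by rewrite mulr_gt0.
move=> n V e w n2 Vn [es eirr] econn [pos [g drawing]] pw.
have dC x y : sp_dist e w x y = sp_dist e w y x by apply: sp_sym.
have dT x y z : sp_dist e w x z <= sp_dist e w x y + sp_dist e w y z.
  exact: sp_triangle.
have dp x y : x != y -> 0 < sp_dist e w x y by apply: sp_gt0.
have d0 x : sp_dist e w x x = 0 by apply: sp_xx.
have nK := drawing_no_K33 drawing.
have Kb : 18 * K <= 2 ^+ 11 by rewrite KE -natrM -natrX ler_nat.
have parts r : 0 < r -> exists P : {ffun 'I_3 -> bool} -> V -> V,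
    (forall c x y, P c x = P c y -> sp_dist e w x y <= K * r) /\
    (forall x, exists c, forall y, sp_dist e w x y <= r -> P c x = P c y).
  by rewrite KE; apply: kpr_partitions.
have [f fP] := linf_embedding d0 dC dT dp K2 Kb parts.
exists (11 * #|{ffun 'I_3 -> bool}| * (trunc_log 2 #|V|).+1 * 16)%N; split.
  have tl : (2 ^ trunc_log 2 n <= n)%N by apply: trunc_logP; rewrite // ltnW.
  have t0 : (0 < trunc_log 2 n)%N by rewrite trunc_log_gt0.
  rewrite card_ffun card_bool card_ord Vn.
  apply: le_trans (_ : (c * trunc_log 2 n)%:R <= _).
    by rewrite ler_nat cE; lia.
  rewrite natrM -mulrA ler_wpM2l ?ler0n // ler_pdivlMl // mulrC.
  rewrite mulr_natl -lnXn // ler_ln ?posrE ?exprn_gt0 // ?ltr0n; last by lia.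
  by rewrite -natrX ler_nat.
have fpos x y : x != y -> 0 < linf_dist (f x) (f y).
  move=> xy; have /andP[lo _] := fP x y; apply: lt_le_trans lo.
  by rewrite divr_gt0 ?dp // mulr_gt0.
have finj : injective f.
  move=> x y fxy; apply/eqP/negP => /negP /fpos.
  by rewrite /linf_dist fxy subrr normr0 ltxx.
have [x0 [y0 n0]] : exists x0 y0 : V, x0 != y0.
  have /card_gt1P[x0 [y0 [_ _ n0]]] : (1 < #|V|)%N by rewrite Vn.
  by exists x0, y0.
have [D Dis] : exists D, is_distortion (sp_dist e w) (@linf_dist R _) f D.
  apply: (least_distortion n0) => // x.
  by rewrite /linf_dist subrr normr0.
exists f, D; split=> //; split=> //.
case: Dis => _; apply; split; first by rewrite mulr_gt0.
exists 1; split=> // x y.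
by have /andP[lo hi] := fP x y; rewrite !mul1r mulrC; split.
Qed.
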